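(* Let $G$ be a crystallographic group of one of the types listed below and let $p\in\mathbb{R}^3$ be a point with trivial stabilizer in $G$. Then the number of facets of the Dirichlet stereohedron $\mathrm{Vor}_{Gp}(p)$ is at most the bound given for the type of $G$: \begin{itemize} \item $F23$: $10$; \item $F432$: $14$; $F\overline{4}3c$: $14$; $F\frac{2}{d}\overline{3}$: $14$; $P23$: $15$; $F4_132$: $17$; \item $P432$: $11$; $I23$: $21$; $P\frac{2}{n}\overline{3}$: $23$; $F\frac{4_1}{d}\overline{3}\frac{2}{n}$: $25$; $P\overline{4}3n$: $23$; $P4_232$: $25$; \item $P\frac{4}{n}\overline{3}\frac{2}{n}$: $23$; $I432$: $22$. \end{itemize}
   Context: A crystallographic group is a discrete subgroup $G\subset\mathrm{Isom}(\mathbb{R}^3)$ containing a lattice of translations of rank $3$ as a subgroup of finite index. Types are given by their international (Hermann–Mauguin) symbols. In terms of the numbers of the International Tables they are: $F23$ (196), $F432$ (209), $F\overline43c$ (219), $F\frac2d\overline3=Fd\overline3$ (203), $P23$ (195), $F4_132$ (210), $P432$ (207), $I23$ (197), $P\frac2n\overline3=Pn\overline3$ (201), $F\frac{4_1}{d}\overline3\frac2n=Fd\overline3c$ (228), $P\overline43n$ (218), $P4_232$ (208), $P\frac4n\overline3\frac2n=Pn\overline3n$ (222), $I432$ (211). These are exactly the 14 types of full cubic groups without reflection planes. A cubic group is full when the subgroup generated by its rotations of order three is, up to similarity, the group generated by the order-three rotations about all lines with directions $(\pm1,\pm1,\pm1)$ through points of $\mathbb{Z}^3$. For $p\in\mathbb{R}^3$,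 $Gp$ is the orbit of $p$, and $\mathrm{Vor}_{Gp}(p)=\{x\in\mathbb{R}^3: |x-p|\le |x-q| \text{ for all } q\in Gp\}$. Facets are 2-dimensional faces. Trivial stabilizer means that the only $g\in G$ with $gp=p$ is the identity. *)

(* Defs.v *)
From HB Require Import structures.
From mathcomp Require Import all_boot all_order all_algebra.
From mathcomp Require Import all_classical all_reals all_analysis.

Set Implicit Arguments.
Unset Strict Implicit.
Unset Printing Implicit Defensive.

Import Order.TTheory GRing.Theory Num.Theory.
Import numFieldNormedType.Exports.

Local Open Scope classical_set_scope.
Local Open Scope ring_scope.

Section EuclideanSpace.
Variable R : realType.
Local Notation E := 'rV[R]_3.

Definition dotv (u v : E) : R := \sum_(i < 3) u 0 i * v 0 i.

(* The library's norm on row vectors is the sup norm; distances here are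
   Euclidean. *)
Definition enorm (u : E) : R := Num.sqrt (dotv u u).

Definition is_isometry (f : E -> E) : Prop :=
  forall x y, enorm (f x - f y) = enorm (x - y).

(* Groups of transformations of R^3, as sets of maps under composition. *)
Definition is_transformation_group (G : set (E -> E)) : Prop :=
  [/\ G id,
      forall f g, G f -> G g -> G (f \o g) &
      forall f, G f -> exists g, [/\ G g, cancel f g & cancel g f]].

Definition generated_group (S : set (E -> E)) : set (E -> E) :=
  smallest is_transformation_group S.

(* G is discrete as a subspace; on isometries the compact-open topology is the
   usual topology of Isom(R^3). *)
Definition is_discrete (G : set (E -> E)) : Prop :=
  (G : set {compact-open, E -> E}) `<=` isolated (G : set {compact-open, E -> E}).

Definition translation (v : E) : E -> E := fun x => x + v.

(* The translations by the integer combinations of the rows of B. *)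
Definition lattice_translations (B : 'M[R]_3) : set (E -> E) :=
  [set translation (map_mx intr z *m B) | z in [set: 'rV[int]_3]].

Definition finite_index (G H : set (E -> E)) : Prop :=
  finite_set [set [set g \o h | h in H] | g in G].

Definition crystallographic (G : set (E -> E)) : Prop :=
  [/\ is_transformation_group G,
      G `<=` is_isometry,
      is_discrete G &
      exists B : 'M[R]_3,
        [/\ B \in unitmx,
            lattice_translations B `<=` G &
            finite_index G (lattice_translations B)]].

Definition orbit_of (G : set (E -> E)) (p : E) : set E := [set g p | g in G].

Definition trivial_stabilizer (G : set (E -> E)) (p : E) : Prop :=
  forall g, G g -> g p = p -> g = id.

Definition Vor (S : set E) (p : E) : set E :=
  [set x | forall q, S q -> enorm (x - p) <= enorm (x - q)].

Definition is_face (P F : set E) : Prop :=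
  exists (c : E) (b : R),
    (forall x, P x -> dotv c x <= b) /\ F = [set x | P x /\ dotv c x = b].

(* The affine hull of F, namely x0 + U for the least such subspace U, has
   dimension d (so F is nonempty). *)
Definition has_affine_dim (F : set E) (d : nat) : Prop :=
  exists (x0 : E) (U : {vspace E}),
    [/\ F x0,
        forall x, F x -> x - x0 \in U,
        forall W : {vspace E}, (forall x, F x -> x - x0 \in W) -> (U <= W)%VS &
        \dim U = d].

Definition facets (P : set E) : set (set E) :=
  [set F | is_face P F /\ has_affine_dim F 2].

End EuclideanSpace.

(* The numbers are those of the International Tables for Crystallography,
   vol. A; a digit or letter followed by b carries a bar in the symbol. *)
Variant full_cubic_type : Set :=
  | F23         (* 196 *)
  | F432        (* 209 *)
  | F4b3c       (* 219 *)
  | F2d3b       (* 203, F 2/d -3 *)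
  | P23         (* 195 *)
  | F41_32      (* 210 *)
  | P432        (* 207 *)
  | I23         (* 197 *)
  | P2n3b       (* 201, P 2/n -3 *)
  | F41d3b2n    (* 228, F 4_1/d -3 2/n = F d -3 c *)
  | P4b3n       (* 218 *)
  | P42_32      (* 208 *)
  | P4n3b2n     (* 222, P 4/n -3 2/n *)
  | I432.       (* 211 *)

Definition facet_bound (t : full_cubic_type) : nat :=
  match t with
  | F23 => 10
  | F432 => 14 | F4b3c => 14 | F2d3b => 14 | P23 => 15 | F41_32 => 17
  | P432 => 11 | I23 => 21 | P2n3b => 23 | F41d3b2n => 25 | P4b3n => 23
  | P42_32 => 25
  | P4n3b2n => 23 | I432 => 22
  end.

Section StandardGroups.
Variable R : realType.
Local Notation E := 'rV[R]_3.

(* A symmetry operation given by its coordinate triplet. *)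
Definition triplet (f : R -> R -> R -> R * R * R) : E -> E := fun u =>
  let: (a, b, c) := f (u 0 0) (u 0 1) (u 0 2%:R) in
  \row_(i < 3) [:: a; b; c]`_i.

Definition primitive_gens : seq (E -> E) :=
  [:: triplet (fun x y z => (x + 1, y, z));
      triplet (fun x y z => (x, y + 1, z));
      triplet (fun x y z => (x, y, z + 1))].

Definition face_centered_gens : seq (E -> E) :=
  primitive_gens ++
  [:: triplet (fun x y z => (x, y + 1/2, z + 1/2));
      triplet (fun x y z => (x + 1/2, y, z + 1/2))].

Definition body_centered_gens : seq (E -> E) :=
  primitive_gens ++ [:: triplet (fun x y z => (x + 1/2, y + 1/2, z + 1/2))].

Definition tetrahedral_gens : seq (E -> E) :=
  [:: triplet (fun x y z => (- x, - y, z));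
      triplet (fun x y z => (- x, y, - z));
      triplet (fun x y z => (z, x, y))].

Definition tetrahedral_screw_gens : seq (E -> E) :=
  [:: triplet (fun x y z => (- x, - y + 1/2, z + 1/2));
      triplet (fun x y z => (- x + 1/2, y + 1/2, - z));
      triplet (fun x y z => (z, x, y))].

(* The generators selected in the International Tables, for cubic cell of side
   1 and, for the groups 201, 203, 222 and 228, origin choice 1. *)
Definition standard_gens (t : full_cubic_type) : seq (E -> E) :=
  match t with
  | F23 => face_centered_gens ++ tetrahedral_gens
  | F432 => face_centered_gens ++ tetrahedral_gens ++
      [:: triplet (fun x y z => (y, x, - z))]
  | F4b3c => face_centered_gens ++ tetrahedral_gens ++
      [:: triplet (fun x y z => (y + 1/2, x + 1/2, z + 1/2))]
  | F2d3b => face_centered_gens ++ tetrahedral_gens ++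
      [:: triplet (fun x y z => (- x + 1/4, - y + 1/4, - z + 1/4))]
  | P23 => primitive_gens ++ tetrahedral_gens
  | F41_32 => face_centered_gens ++ tetrahedral_screw_gens ++
      [:: triplet (fun x y z => (y + 3/4, x + 1/4, - z + 3/4))]
  | P432 => primitive_gens ++ tetrahedral_gens ++
      [:: triplet (fun x y z => (y, x, - z))]
  | I23 => body_centered_gens ++ tetrahedral_gens
  | P2n3b => primitive_gens ++ tetrahedral_gens ++
      [:: triplet (fun x y z => (- x + 1/2, - y + 1/2, - z + 1/2))]
  | F41d3b2n => face_centered_gens ++ tetrahedral_screw_gens ++
      [:: triplet (fun x y z => (y + 3/4, x + 1/4, - z + 3/4));
          triplet (fun x y z => (- x + 3/4, - y + 3/4, - z + 3/4))]
  | P4b3n => primitive_gens ++ tetrahedral_gens ++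
      [:: triplet (fun x y z => (y + 1/2, x + 1/2, z + 1/2))]
  | P42_32 => primitive_gens ++ tetrahedral_gens ++
      [:: triplet (fun x y z => (y + 1/2, x + 1/2, - z + 1/2))]
  | P4n3b2n => primitive_gens ++ tetrahedral_gens ++
      [:: triplet (fun x y z => (y, x, - z));
          triplet (fun x y z => (- x + 1/2, - y + 1/2, - z + 1/2))]
  | I432 => body_centered_gens ++ tetrahedral_gens ++
      [:: triplet (fun x y z => (y, x, - z))]
  end.

Definition standard_group (t : full_cubic_type) : set (E -> E) :=
  generated_group [set f | f \in standard_gens t].

(* G is affinely conjugate to the standard group; f \o phi = phi \o g reads
   f = phi g phi^-1. None of these types belongs to an enantiomorphic pair, so
   allowing orientation-reversing phi does not enlarge the classes. *)
Definition has_type (G : set (E -> E)) (t : full_cubic_type) : Prop :=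
  exists (A : 'M[R]_3) (v : E),
    let phi := fun x : E => x *m A + v in
    A \in unitmx /\
    forall f, G f <-> exists2 g, standard_group t g & f \o phi = phi \o g.

End StandardGroups.

(* Main.v *)
From HB Require Import structures.
From Stdlib Require Import ZArith.
Require Import Defs.
From mathcomp Require Import all_boot all_order all_algebra.
From mathcomp Require Import all_classical all_reals all_analysis.
From mathcomp Require Import ssrZ zify ring lra.

(** For an isometry [g], [f_g(x,p) = |x - gp|^2 - |x - p|^2] is affine in [x]
    and affine in [p], so on a product of two simplices its sign is decided at
    the pairs of vertices.  If [gp] contributes a facet to the cell of [p], then
    near that facet the cell has a point [y] at which [f_g] is positive, smaller
    than [1] and smaller than [f_h] for any finite set of other [h].  Conjugation
    by the normaliser of the group moves [p] into a fixed tetrahedron or its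
    mirror image, which is cut into few simplices [C]; the space around [C] is
    cut into simplices [X].  No such [y] lies in [X] when some [f_h] is nowhere
    positive on [X * C], and [g] contributes nothing in [X] when [f_g > f_h] or
    [f_g > f_h + f_k] can be read off at the vertex pairs.  For each [C] the
    number of elements that survive in some [X] is within the stated bound. *)

(** The point p ranges over a continuum, so the count has to be certified on a whole simplex C at
    once. For an isometry g the difference |gp|^2 - |p|^2 is affine in p, which is why f_g is affine
    in each variable. For y in X and p in C a single system of product weights on the vertex pairs
    expresses all the f_g(y, p) simultaneously, so linear inequalities between these forms pass from
    the vertices to (y, p). On the facet itself f_g vanishes, and a simplex discarded because f_g is
    nonpositive on it may contain the whole facet; a small step towards p makes every form positive,
    f_g included. Vertices and translations are integral in the chosen unit, hence so are the values
    at vertex pairs: f_g(y, p) < 1 forces one of them to be at most 0, and it also bounds |y - gp|.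
    Both facts cut the elements to be examined down to a finite list. The elements that survive for
    some p in C can be more numerous than the facets for any one p; smaller simplices C serve to
    bring their number below the bound. *)

Set Implicit Arguments.
Unset Strict Implicit.
Unset Printing Implicit Defensive.
Import Order.TTheory GRing.Theory Num.Theory.

(** * The certificate checker, in exact integer arithmetic *)

Section Computation.
Local Open Scope Z_scope.

(* The virtual machine evaluates the arguments of [andb], [orb], [has] and
   [all] eagerly; these variants stop early. *)
Fixpoint lazy_has (T : Type) (a : T -> bool) (s : seq T) : bool :=
  if s is x :: s' then if a x then true else lazy_has a s' else false.
Fixpoint lazy_all (T : Type) (a : T -> bool) (s : seq T) : bool :=
  if s is x :: s' then if a x then lazy_all a s' else false else true.

Definition triple (T : Type) : Type := (T * T * T)%type.
Definition point := triple Z.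

(** In cubic axes every linear part permutes the coordinate axes up to sign, so a matrix is three
    signed axes and matrix products involve no arithmetic. *)
Variant row := PX | PY | PZ | NX | NY | NZ.
Definition rows := triple row.

Definition row_apply (T : Type) (opp : T -> T) (r : row) (v : triple T) : T :=
  let: (x, y, z) := v in
  match r with
  | PX => x | PY => y | PZ => z | NX => opp x | NY => opp y | NZ => opp z
  end.

Definition rows_apply (T : Type) (opp : T -> T) (M : rows) (v : triple T) :
    triple T :=
  let: (r1, r2, r3) := M in
  (row_apply opp r1 v, row_apply opp r2 v, row_apply opp r3 v).

Definition row_opp (r : row) : row :=
  match r with
  | PX => NX | PY => NY | PZ => NZ | NX => PX | NY => PY | NZ => PZ
  end.

Definition row_axis (r : row) : nat :=
  match r with PX | NX => 0%N | PY | NY => 1%N | PZ | NZ => 2%N end.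

Definition row_sign (r : row) : bool :=
  match r with PX | PY | PZ => true | _ => false end.

Definition row_eqb (r s : row) : bool :=
  match r, s with
  | PX, PX | PY, PY | PZ, PZ | NX, NX | NY, NY | NZ, NZ => true
  | _, _ => false
  end.

Definition padd (u v : point) : point :=
  let: (a, b, c) := u in let: (x, y, z) := v in (a + x, b + y, c + z).
Definition psub (u v : point) : point :=
  let: (a, b, c) := u in let: (x, y, z) := v in (a - x, b - y, c - z).
Definition pscale (k : Z) (u : point) : point :=
  let: (a, b, c) := u in (k * a, k * b, k * c).
Definition pdot (u v : point) : Z :=
  let: (a, b, c) := u in let: (x, y, z) := v in a * x + b * y + c * z.
Definition pdist (u v : point) : Z := let d := psub u v in pdot d d.
Definition point_eqb (u v : point) : bool :=
  let: (a, b, c) := u in let: (x, y, z) := v in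
  if a =? x then if b =? y then c =? z else false else false.

Definition op := (rows * point)%type.

Definition op_eqb (g h : op) : bool :=
  let: ((a, b, c), t) := g in let: ((x, y, z), s) := h in
  if row_eqb a x then if row_eqb b y then if row_eqb c z then point_eqb t s
  else false else false else false.

Definition op_id : op := ((PX, PY, PZ), (0, 0, 0)).

Definition op_mul (g h : op) : op :=
  let: (M, t) := g in let: (M2, s) := h in
  (rows_apply row_opp M M2, padd (rows_apply Z.opp M s) t).

(* Group elements are tracked modulo the translations by Z^3, in units of a
   quarter of the cell side. *)
Definition op_red (g : op) : op :=
  let: (M, (a, b, c)) := g in (M, (a mod 4, b mod 4, c mod 4)).

Definition op_mem (GL : seq op) (g : op) : bool := lazy_has (op_eqb g) GL.

Fixpoint closure_from (n : nat) (gens acc front : seq op) : seq op :=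
  if n isn't n'.+1 then acc else
  let: (acc', front') :=
    foldl (fun st a =>
      foldl (fun st' g => let b := op_red (op_mul g a) in
        if op_mem st'.1 b then st' else (b :: st'.1, b :: st'.2)) st gens)
      (acc, [::]) front in
  if front' is [::] then acc' else closure_from n' gens acc' front'.

(** The fuel 30 only bounds the number of rounds; [group_ok] confirms afterwards that the resulting
    list is stable under the generators. *)
Definition closure_mod (gens : seq op) : seq op :=
  closure_from 30 gens [:: op_id] [:: op_id].

(* A form (n, a) stands for x |-> n - a.x; mkform h c is the form
   x |-> |x - h c|^2 - |x - c|^2. *)
Definition form := (Z * point)%type.
Definition mkform (h : op) (c : point) : form :=
  let: (M, t) := h in
  let m := rows_apply Z.opp M c in
  (2 * pdot m t + pdot t t, pscale 2 (psub (padd m t) c)).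
Definition form_eval (f : form) (x : point) : Z := f.1 - pdot f.2 x.

Definition opforms := (op * seq form)%type.
Definition mkforms (C : seq point) (h : op) : opforms := (h, map (mkform h) C).
Definition values (k : opforms) (X : seq point) : seq Z :=
  flatten (map (fun x => map (fun f => form_eval f x) k.2) X).

Definition nonpos (z : Z) : bool := z <=? 0.

Definition edge_order (e : nat) (X : seq point) : seq point :=
  if X is [:: a; b; c; d] then
    match e with
    | 0%N => [:: a; b; c; d] | 1%N => [:: a; c; b; d] | 2%N => [:: a; d; b; c]
    | 3%N => [:: b; c; a; d] | 4%N => [:: b; d; a; c] | _ => [:: c; d; a; b]
    end
  else X.

Definition point_div (u : point) (k : Z) : point :=
  let: (a, b, c) := u in (a / k, b / k, c / k).

(** A cut is made only if the dividing point is integral, so that vertices stay in Z^3 and every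
    evaluation is exact. *)
Definition cut (e : nat) (i j : Z) (X : seq point) :
    option (seq point * seq point) :=
  if edge_order e X is [:: p; q; r; s] then
    let w := padd (pscale i p) (pscale j q) in
    let m := point_div w (i + j) in
    if point_eqb (pscale (i + j) m) w then
      Some ([:: p; m; r; s], [:: m; q; r; s])
    else None
  else None.

(** Bisecting a longest edge keeps the simplices from becoming thin; soundness holds for any choice
    of edge. *)
Definition longest_edge (X : seq point) : nat :=
  let len e := if edge_order e X is p :: q :: _ then pdist p q else 0 in
  (foldl (fun acc e => let l := len e in if acc.2 <? l then (e, l) else acc)
    (0%N, len 0%N) [:: 1; 2; 3; 4; 5]%N).1.

Fixpoint survivors (d : nat) (ks : seq opforms) (X : seq point) :
    seq (seq point) :=
  let ev := map (fun k => (k, values k X)) ks in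
  if lazy_has (fun e => lazy_all nonpos e.2) ev then [::] else
  if d isn't d'.+1 then [:: X] else
  if cut (longest_edge X) 1 1 X is Some (A, B) then
    (* A competitor that is positive at every vertex pair stays positive on both halves and can
       discard no part of them. *)
    let ks' := map fst (seq.filter (fun e => lazy_has nonpos e.2) ev) in
    survivors d' ks' A ++ survivors d' ks' B
  else [:: X].

Definition extent (l : seq Z) : Z * Z :=
  if l is z :: l' then
    foldl (fun m x => (Z.min m.1 x, Z.max m.2 x)) (z, z) l'
  else (0, 0).
Definition box (l : seq point) : triple (Z * Z) :=
  (extent (map (row_apply Z.opp PX) l), extent (map (row_apply Z.opp PY) l),
   extent (map (row_apply Z.opp PZ) l)).

Fixpoint zrange (n : nat) (a : Z) : seq Z :=
  if n is n'.+1 then a :: zrange n' (a + 1) else [::].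

(* The translations t = S (tau + 4 k) for which the interval m + t meets the
   r-neighbourhood of the interval B, with the squared distance of m + t to B. *)
Definition shifts (S : Z) (B : Z * Z) (r : Z) (m : Z * Z) (tau : Z) :
    seq (Z * Z) :=
  let lo := - ((m.2 + S * tau + r - B.1) / (4 * S)) in
  let hi := (B.2 + r - m.1 - S * tau) / (4 * S) in
  map (fun k => let t := S * (tau + 4 * k) in
         let g := Z.max 0 (Z.max (m.1 + t - B.2) (B.1 - m.2 - t)) in (t, g * g))
    (zrange (Z.to_nat (hi - lo + 1)) lo).

Definition candidates_of (S : Z) (C : seq point) (B : triple (Z * Z)) (rho r : Z)
    (g : op) : seq op :=
  let: ((a, b, c), (t1, t2, t3)) := g in
  let: (B1, B2, B3) := B in
  let rg a := extent (map (row_apply Z.opp a) C) in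
  let l1 := shifts S B1 r (rg a) t1 in
  let l2 := shifts S B2 r (rg b) t2 in
  let l3 := shifts S B3 r (rg c) t3 in
  flatten (map (fun x1 => flatten (map (fun x2 =>
    if rho <? x1.2 + x2.2 then [::] else
    flatten (map (fun x3 =>
      if rho <? x1.2 + x2.2 + x3.2 then [::] else
      let h := ((a, b, c), (x1.1, x2.1, x3.1)) in
      if op_eqb h op_id then [::] else [:: h]) l3)) l2)) l1).

Definition candidates (S : Z) (GL : seq op) (C : seq point)
    (B : triple (Z * Z)) (rho : Z) : seq op :=
  (* [Z.sqrt] rounds down; adding 1 gives an integer above the true root. *)
  flatten (map (candidates_of S C B rho (Z.sqrt rho + 1)) GL).

(** The Kuhn triangulation of a box: one simplex for each order in which the coordinates are raised
    from 0 to their final values. *)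
Definition kuhn (a b c : Z) : seq (seq point) :=
  [:: [:: (0, 0, 0); (a, 0, 0); (a, b, 0); (a, b, c)];
      [:: (0, 0, 0); (a, 0, 0); (a, 0, c); (a, b, c)];
      [:: (0, 0, 0); (0, b, 0); (a, b, 0); (a, b, c)];
      [:: (0, 0, 0); (0, b, 0); (0, b, c); (a, b, c)];
      [:: (0, 0, 0); (0, 0, c); (a, 0, c); (a, b, c)];
      [:: (0, 0, 0); (0, 0, c); (0, b, c); (a, b, c)]].
Definition big_cube (u : Z) : seq (seq point) :=
  flatten (map (fun a => flatten (map (fun b => flatten (map (fun c =>
    kuhn a b c) [:: u; - u])) [:: u; - u])) [:: u; - u]).

(** Only the common prefix is compared. The lists that occur all have length |X| |C|, by
    [size_values]. *)
Fixpoint all_le (a b : seq Z) : bool :=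
  match a, b with
  | x :: a', y :: b' => if x <=? y then all_le a' b' else false
  | _, _ => true
  end.
Fixpoint all_sum_le (a b c : seq Z) : bool :=
  match a, b, c with
  | x :: a', y :: b', z :: c' => if x + y <=? z then all_sum_le a' b' c' else false
  | _, _, _ => true
  end.

Definition entry := (opforms * seq Z)%type.

Definition dominated (g : op) (vg : seq Z) (tb : seq entry) : bool :=
  lazy_has (fun k => if all_le k.2 vg then ~~ op_eqb g k.1.1 else false) tb.

Fixpoint pair_dominated (g : op) (vg : seq Z) (tb : seq entry) : bool :=
  if tb is k :: tb' then
    if lazy_has (fun k' => if all_sum_le k.2 k'.2 vg then
         if op_eqb g k.1.1 then false else ~~ op_eqb g k'.1.1 else false) tb'
    then true else pair_dominated g vg tb'
  else false.

Definition total (e : entry) : Z := foldl Z.add 0 e.2.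
Fixpoint insert (e : Z * entry) (l : seq (Z * entry)) : seq (Z * entry) :=
  if l is a :: l' then if e.1 <=? a.1 then e :: l else a :: insert e l'
  else [:: e].
(** Sorting by total puts the smallest forms, which are the likeliest to dominate, in front. The
    filter loses no single dominator: a form below one with a nonpositive value has a nonpositive
    value itself. *)
Definition table (R : seq opforms) (X : seq point) : seq entry :=
  map snd (foldr (fun e l => insert (total e, e) l) [::]
    (seq.filter (fun e => lazy_has nonpos e.2) (map (fun k => (k, values k X)) R))).

Definition excluded (tb : seq entry) (e : entry) : bool :=
  if lazy_all nonpos e.2 then true else
  if dominated e.1.1 e.2 tb then true else
  (* The search over pairs is quadratic; restricting it to the 40 smallest forms saves time and can
     only exclude fewer elements. *)
  pair_dominated e.1.1 e.2 (take 40 tb).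

(** [acc] is carried through all simplices around one cell, so its final size counts distinct
    elements, and an element already counted is not tested again. *)
Fixpoint scan (tb l : seq entry) (acc : seq op) : seq op :=
  if l is e :: l' then
    scan tb l' (if op_mem acc e.1.1 then acc else
                if excluded tb e then acc else e.1.1 :: acc)
  else acc.

Fixpoint neighbours (R : seq opforms) (U : seq (seq point)) (acc : seq op) :
    seq op :=
  if U is X :: U' then
    let tb := table R X in neighbours R U' (scan tb tb acc)
  else acc.

Definition cell_ok (S : Z) (GL : seq op) (n : nat) (kappa : Z) (d : nat)
    (C : seq point) : bool :=
  let K := map (mkforms C) (candidates S GL C (box C) kappa) in
  let U := flatten (map (survivors d K) (big_cube (4 * S))) in
  let UP := flatten U in
  (* If f_g(y, p) < 1 with y in a surviving simplex, then |y - gp|^2 < 1 + |y - p|^2 and the last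
     distance is largest at a vertex pair; so the elements within [rho] of the box around the
     survivors are all that matter. *)
  let rho := 1 + foldl Z.max 0
    (flatten (map (fun x => map (pdist x) C) UP)) in
  let R := seq.filter
    (fun k => lazy_has (fun x => lazy_has (fun f => nonpos (form_eval f x)) k.2) UP)
    (map (mkforms C) (candidates S GL C (box UP) rho)) in
  (size (neighbours R U [::]) <= n)%N.

(* Check kappa d: the simplices that cover space are bisected d times, and those that some
   competitor within squared distance kappa of the cell discards are dropped. *)
Inductive plan :=
  | Check of Z & nat
  | Cut of nat & Z & Z & plan & plan.

Fixpoint plan_ok (S : Z) (GL : seq op) (n : nat) (pl : plan) (C : seq point) :
    bool :=
  match pl with
  | Check kappa d => cell_ok S GL n kappa d C
  | Cut e i j pl1 pl2 =>
      if 0 <? i then if 0 <? j then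
        if cut e i j C is Some (A, B) then
          if plan_ok S GL n pl1 A then plan_ok S GL n pl2 B else false
        else false else false
      else false
  end.

End Computation.

#[local] Arguments Z.mul : simpl never.
#[local] Arguments Z.add : simpl never.
#[local] Arguments Z.sub : simpl never.
#[local] Arguments Z.opp : simpl never.
#[local] Arguments Z.div : simpl never.
#[local] Arguments Z.modulo : simpl never.
#[local] Arguments Z.sqrt : simpl never.

(** * Boolean reflection and the embedding of integers *)

Lemma lazy_hasE (T : Type) (a : T -> bool) (s : seq T) : lazy_has a s = has a s.
Proof. by elim: s => //= x s <-; case: (a x). Qed.

Lemma lazy_allE (T : Type) (a : T -> bool) (s : seq T) : lazy_all a s = all a s.
Proof. by elim: s => //= x s <-; case: (a x). Qed.

Lemma row_eqP : Equality.axiom row_eqb.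
Proof. by case; case; constructor. Qed.
HB.instance Definition _ := hasDecEq.Build row row_eqP.

Lemma point_eqbP (u v : point) : reflect (u = v) (point_eqb u v).
Proof.
move: u v => [[a b] c] [[x y] z]; apply: (iffP idP) => /=.
  by case: Z.eqb_spec => // ->; case: Z.eqb_spec => // ->; case: Z.eqb_spec => // ->.
by case=> -> -> ->; rewrite !Z.eqb_refl.
Qed.

Lemma op_eqbE (g h : op) : op_eqb g h = (g == h).
Proof.
apply/idP/eqP; move: g h => [[[a b] c] t] [[[x y] z] s] /=.
  case: row_eqP => // ->; case: row_eqP => // ->; case: row_eqP => // ->.
  by move/point_eqbP => ->.
by case=> -> -> -> ->; rewrite !(introT (row_eqP _ _)) //; apply/point_eqbP.
Qed.

Lemma op_memE (GL : seq op) (g : op) : op_mem GL g = (g \in GL).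
Proof.
rewrite /op_mem lazy_hasE -has_pred1; apply: eq_has => x /=.
by rewrite op_eqbE eq_sym.
Qed.

Section Embedding.
Variable R : realFieldType.
Local Open Scope ring_scope.

Definition of_Z (z : Z) : R := (int_of_Z z)%:~R.

Lemma of_ZD a b : of_Z (Z.add a b) = of_Z a + of_Z b.
Proof. by rewrite /of_Z -rmorphD; congr (_%:~R); lia. Qed.
Lemma of_ZN a : of_Z (Z.opp a) = - of_Z a.
Proof. by rewrite /of_Z -rmorphN; congr (_%:~R); lia. Qed.
Lemma of_ZB a b : of_Z (Z.sub a b) = of_Z a - of_Z b.
Proof. by rewrite /of_Z -rmorphB; congr (_%:~R); lia. Qed.
Lemma of_ZM a b : of_Z (Z.mul a b) = of_Z a * of_Z b.
Proof. by rewrite /of_Z -rmorphM; congr (_%:~R); lia. Qed.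
Lemma of_Z0 : of_Z Z0 = 0. Proof. by []. Qed.
Lemma of_Z1 : of_Z (Zpos 1) = 1. Proof. by []. Qed.
Lemma of_Z2 : of_Z (Zpos 2) = 2. Proof. by []. Qed.
Lemma of_Z4 : of_Z (Zpos 4) = 4. Proof. by []. Qed.
Lemma of_Z_le a b : Z.le a b -> of_Z a <= of_Z b.
Proof. by move=> ab; rewrite /of_Z ler_int; lia. Qed.
Lemma of_Z_lt a b : Z.lt a b -> of_Z a < of_Z b.
Proof. by move=> ab; rewrite /of_Z ltr_int; lia. Qed.
Lemma of_Z_leE a b : of_Z a <= of_Z b -> Z.le a b.
Proof. by rewrite /of_Z ler_int; lia. Qed.
Lemma of_Z_ltE a b : of_Z a < of_Z b -> Z.lt a b.
Proof. by rewrite /of_Z ltr_int; lia. Qed.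

End Embedding.

(** * Affine forms on products of simplices *)

Section Weights.
Variable R : realFieldType.
Local Open Scope ring_scope.
Local Notation zr := (@of_Z R).
Implicit Types (w m : seq R) (h : op) (x y p : triple R) (X C : seq point).

Fixpoint wsum w (a : seq R) : R :=
  match w, a with x :: w', y :: a' => x * y + wsum w' a' | _, _ => 0 end.

Definition weights (n : nat) w : Prop :=
  [/\ size w = n, all (>= 0) w & \sum_(a <- w) a = 1].

Definition of_point (v : point) : triple R :=
  let: (a, b, c) := v in (zr a, zr b, zr c).

Definition tdot (u v : triple R) : R :=
  let: (a, b, c) := u in let: (x, y, z) := v in a * x + b * y + c * z.
Definition tadd (u v : triple R) : triple R :=
  let: (a, b, c) := u in let: (x, y, z) := v in (a + x, b + y, c + z).
Definition tsub (u v : triple R) : triple R :=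
  let: (a, b, c) := u in let: (x, y, z) := v in (a - x, b - y, c - z).
Definition tdist (u v : triple R) : R := tdot (tsub u v) (tsub u v).

Definition coord (r : row) (v : point) : R := zr (row_apply Z.opp r v).

Definition comb w X : triple R :=
  (wsum w [seq coord PX v | v <- X], wsum w [seq coord PY v | v <- X],
   wsum w [seq coord PZ v | v <- X]).

Definition hull X y : Prop := exists2 w, weights (size X) w & y = comb w X.

Definition op_apply h p : triple R :=
  tadd (rows_apply -%R h.1 p) (of_point h.2).

(** This is f_h with |Mp|^2 cancelled against |p|^2, which makes it affine in p by its very form;
    [gapE] identifies it with the difference of squared distances when M is a signed permutation. *)
Definition gap h x p : R :=
  let m := rows_apply -%R h.1 p in let t := of_point h.2 in
  2 * tdot m t + tdot t t - 2 * tdot (tsub (tadd m t) p) x.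

Definition orthogonal_rows (M : rows) : bool :=
  let: (r1, r2, r3) := M in
  [&& row_axis r1 != row_axis r2, row_axis r1 != row_axis r3 &
      row_axis r2 != row_axis r3].

Lemma gapE h x p : orthogonal_rows h.1 ->
  gap h x p = tdist x (op_apply h p) - tdist x p.
Proof.
case: h => -[[r1 r2] r3] [[t1 t2] t3] /=; case: x => -[x1 x2] x3.
case: p => -[p1 p2] p3; rewrite /gap /tdist /op_apply /=.
by case: r1; case: r2; case: r3 => // _ /=; ring.
Qed.

Lemma gap_vertex h v c :
  gap h (of_point v) (of_point c) = zr (form_eval (mkform h c) v).
Proof.
case: h => -[[r1 r2] r3] [[t1 t2] t3]; case: v => -[v1 v2] v3.
case: c => -[c1 c2] c3; rewrite /gap /form_eval /mkform /=.
rewrite !(of_ZD, of_ZB, of_ZN, of_ZM, of_Z2).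
have E r : zr (row_apply Z.opp r (c1, c2, c3)) =
    row_apply -%R r (zr c1, zr c2, zr c3) by case: r; rewrite //= of_ZN.
by move: (E r1) (E r2) (E r3) => /= -> -> ->; ring.
Qed.

Lemma wsum_affine w (n a b c : R) X : size w = size X ->
  (\sum_(i <- w) i) * n - (a * (comb w X).1.1 + b * (comb w X).1.2 + c * (comb w X).2)
  = wsum w [seq n - (a * coord PX v + b * coord PY v + c * coord PZ v) | v <- X].
Proof.
rewrite /comb /=; elim: w X => [|x w IH] [|v X] //= => [_|[/IH E]].
  by rewrite big_nil; ring.
by rewrite big_cons -E; ring.
Qed.

Lemma gap_comb_x h w X p : weights (size X) w ->
  gap h (comb w X) p = wsum w [seq gap h (of_point v) p | v <- X].
Proof.
move=> [sw _ w1]; rewrite /gap.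
set n := 2 * _ + _; set d := tsub _ p; case: d => -[d1 d2] d3.
have := wsum_affine n (2 * d1) (2 * d2) (2 * d3) sw; rewrite w1 mul1r => E.
transitivity (n - (2 * d1 * (comb w X).1.1 + 2 * d2 * (comb w X).1.2
   + 2 * d3 * (comb w X).2)); first by rewrite /comb /=; ring.
rewrite E; congr wsum; apply: eq_map => -[[v1 v2] v3] /=.
by rewrite /coord /=; ring.
Qed.

Lemma gap_comb_p h w C x : weights (size C) w ->
  gap h x (comb w C) = wsum w [seq gap h x (of_point c) | c <- C].
Proof.
case: h => -[[r1 r2] r3] [[t1 t2] t3]; case: x => -[x1 x2] x3.
move=> [sw _ w1].
set h := (_, _).
pose N : R := zr t1 ^+ 2 + zr t2 ^+ 2 + zr t3 ^+ 2
  - 2 * (zr t1 * x1 + zr t2 * x2 + zr t3 * x3).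
pose c1 := 2 * (zr t1 - x1); pose c2 := 2 * (zr t2 - x2); pose c3 := 2 * (zr t3 - x3).
(* [k i r z] is what row r contributes to coordinate i when the transposed matrix is applied; thus
   [s i] is minus the coefficient of the i-th coordinate of p. *)
pose k (i : nat) (r : row) (z : R) := (if row_axis r == i then (if row_sign r then z else - z) else 0).
pose s i (z : R) := - (k i r1 c1 + k i r2 c2 + k i r3 c3 + 2 * z).
have gE (p : triple R) : gap h (x1, x2, x3) p =
    N - (s 0%N x1 * p.1.1 + s 1%N x2 * p.1.2 + s 2%N x3 * p.2).
  case: p => -[p1 p2] p3.
  have E r c : row_apply -%R r (p1, p2, p3) * c =
     k 0%N r c * p1 + k 1%N r c * p2 + k 2%N r c * p3.
    by case: r; rewrite /k /=; ring.
  transitivity (N + (row_apply -%R r1 (p1, p2, p3) * c1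
    + row_apply -%R r2 (p1, p2, p3) * c2 + row_apply -%R r3 (p1, p2, p3) * c3)
    + 2 * (p1 * x1 + p2 * x2 + p3 * x3)).
    pose G a1 a2 a3 := 2 * (a1 * zr t1 + a2 * zr t2 + a3 * zr t3)
      + (zr t1 * zr t1 + zr t2 * zr t2 + zr t3 * zr t3)
      - 2 * ((a1 + zr t1 - p1) * x1 + (a2 + zr t2 - p2) * x2 + (a3 + zr t3 - p3) * x3).
    rewrite -[LHS]/(G (row_apply -%R r1 (p1, p2, p3)) (row_apply -%R r2 (p1, p2, p3))
      (row_apply -%R r3 (p1, p2, p3))).
    move: (row_apply _ r1 _) (row_apply _ r2 _) (row_apply _ r3 _) => a1 a2 a3.
    by rewrite /G /N /c1 /c2 /c3; ring.
  by rewrite !E /s /=; ring.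
have := wsum_affine N (s 0%N x1) (s 1%N x2) (s 2%N x3) sw.
rewrite w1 mul1r => E; rewrite gE E; congr wsum; apply: eq_map => -[[v1 v2] v3].
by rewrite gE /coord.
Qed.

Lemma wsum_cat w m (a b : seq R) : size w = size a ->
  wsum (w ++ m) (a ++ b) = wsum w a + wsum m b.
Proof.
elim: w a => [|x w IH] [|y a] //=; first by rewrite add0r.
by case=> /IH ->; rewrite addrA.
Qed.

Lemma wsum_scale (k : R) w (a : seq R) : wsum [seq k * b | b <- w] a = k * wsum w a.
Proof.
elim: w a => [|x w IH] [|y a] //=; rewrite ?mulr0 //.
by rewrite IH mulrDr mulrA.
Qed.

(** The weights are the products of those of y and p, in the order of [values]. What matters is that
    one W serves all h, so that different forms can be compared and added. *)
Lemma gap_hull X C y p : hull X y -> hull C p ->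
  exists2 W, weights (size X * size C) W &
    forall h, gap h y p = wsum W (map zr (values (mkforms C h) X)).
Proof.
move=> [w ww ->] [m mm ->].
exists (flatten [seq [seq a * b | b <- m] | a <- w]).
  case: ww mm => sw w0 w1 [sm m0 m1]; split.
  - rewrite -sw -sm size_flatten /shape -map_comp.
    rewrite (@eq_map _ _ _ (fun=> size m)); last by move=> a /=; rewrite size_map.
    by rewrite sumnE big_map big_const_seq count_predT iter_addn_0 mulnC.
  - apply/allP => z /flattenP [s /mapP [a aw ->] /mapP [b bm ->]].
    by apply: mulr_ge0; [exact: (allP w0) | exact: (allP m0)].
  - rewrite -w1 big_flatten big_map; apply: eq_bigr => a _.
    by rewrite big_map -mulr_sumr m1 mulr1.
move=> h; rewrite gap_comb_x //.
have -> : [seq gap h (of_point v) (comb m C) | v <- X] =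
   [seq wsum m [seq zr (form_eval (mkform h c) v) | c <- C] | v <- X].
  apply: eq_map => v; rewrite gap_comb_p //; congr wsum.
  by apply: eq_map => c; rewrite gap_vertex.
rewrite /values /mkforms /=.
case: ww => sw _ _; case: mm => sm _ _.
elim: w X sw => [|a w IH] [|v X] //= [/IH ->].
rewrite map_cat wsum_cat; last by rewrite !size_map.
by rewrite wsum_scale -!map_comp.
Qed.

Lemma wsum_le n W (a b : seq Z) : weights n W -> size a = n -> size b = n ->
  all_le a b -> wsum W (map zr a) <= wsum W (map zr b).
Proof.
move=> [sW W0 _]; rewrite -sW => {sW}.
elim: W W0 a b => [|w W IH] //= /andP [w0 W0] [|x a] [|y b] //= [sa] [sb].
case: (Z.leb_spec x y) => [xy ab|_ //]; apply: lerD; last exact: IH.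
by apply: ler_wpM2l => //; exact: of_Z_le xy.
Qed.

Lemma wsum_sum_le n W (a b c : seq Z) : weights n W ->
  size a = n -> size b = n -> size c = n -> all_sum_le a b c ->
  wsum W (map zr a) + wsum W (map zr b) <= wsum W (map zr c).
Proof.
move=> [sW W0 _]; rewrite -sW => {sW}.
elim: W W0 a b c => [|w W IH]; first by move=> *; rewrite /= ?addr0.
move=> /= /andP [w0 W0] [|x a] [|y b] [|z c] //= [sa] [sb] [sc].
case: (Z.leb_spec (x + y) z) => [xy abc|_ //].
have := IH W0 a b c sa sb sc abc.
have : w * (zr x + zr y) <= w * zr z by rewrite ler_wpM2l // -of_ZD; exact: of_Z_le xy.
rewrite mulrDr; lra.
Qed.

Lemma wsum_const n W (k : R) : weights n W -> wsum W (nseq n k) = k.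
Proof.
move=> [sW _ W1]; rewrite -sW -[RHS]mul1r -W1; elim: (W) => [|w V IH] /=.
  by rewrite big_nil mul0r.
by rewrite IH big_cons mulrDl.
Qed.

Lemma wsum_ge n W (k : Z) (a : seq Z) : weights n W -> size a = n ->
  all (fun z => Z.leb k z) a -> zr k <= wsum W (map zr a).
Proof.
move=> wW sa ka; rewrite -(wsum_const (zr k) wW) -map_nseq.
apply: wsum_le wW _ _ _ => //; rewrite ?size_nseq // -sa.
elim: a ka {sa} => //= z a IH /andP [kz ka].
by rewrite IH // kz.
Qed.

Lemma wsum_le0 n W (a : seq Z) : weights n W -> size a = n ->
  all nonpos a -> wsum W (map zr a) <= 0.
Proof.
move=> wW sa ka; have <- : wsum W (nseq n (zr Z0)) = 0 := wsum_const _ wW.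
rewrite -map_nseq.
apply: wsum_le wW _ _ _ => //; rewrite ?size_nseq // -sa.
elim: a ka {sa} => //= z a IH /andP [kz ka].
by rewrite -/(nonpos z) kz IH.
Qed.

Lemma size_values X C h : size (values (mkforms C h) X) = (size X * size C)%N.
Proof.
rewrite /values size_flatten /shape -map_comp.
rewrite (@eq_map _ _ _ (fun=> size C)); last by move=> a /=; rewrite !size_map.
by rewrite sumnE big_map big_const_seq count_predT iter_addn_0 mulnC.
Qed.

End Weights.

(** * Subdivision of tetrahedra *)

Section Subdivision.
Variable R : realFieldType.
Local Open Scope ring_scope.
Local Notation zr := (@of_Z R).
Implicit Types (w : seq R) (h g : op) (y p : triple R) (X C : seq point).

Lemma hull4P (a b c d : point) y :
  hull [:: a; b; c; d] y <->
  exists w1 w2 w3 w4 : R, [/\ [/\ 0 <= w1, 0 <= w2, 0 <= w3 & 0 <= w4],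
    w1 + w2 + w3 + w4 = 1 &
    forall r, row_apply -%R r y = w1 * coord R r a + w2 * coord R r b
                                + w3 * coord R r c + w4 * coord R r d].
Proof.
split.
  case=> -[|w1 [|w2 [|w3 [|w4 [|? ?]]]]] [] //= _ /and5P [w1_ge w2_ge w3_ge w4_ge _].
  rewrite !big_cons big_nil => w1E ->; exists w1, w2, w3, w4; split => //.
    by rewrite -w1E !addrA addr0.
  move: a b c d => [[a1 a2] a3] [[b1 b2] b3] [[c1 c2] c3] [[d1 d2] d3].
  by case; rewrite /comb /coord /= ?of_ZN; ring.
move=> [w1 [w2 [w3 [w4 [[w1_ge w2_ge w3_ge w4_ge] sw yE]]]]].
exists [:: w1; w2; w3; w4].
  split=> //=; first by rewrite w1_ge w2_ge w3_ge w4_ge.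
  by rewrite !big_cons big_nil addr0 !addrA.
case: y yE => -[y1 y2] y3 yE; rewrite /comb /= !addr0 !addrA.
by rewrite -(yE PX) -(yE PY) -(yE PZ).
Qed.

Lemma hull_edge_order e X y : hull X y -> hull (edge_order e X) y.
Proof.
case: X => [|a [|b [|c [|d [|? ?]]]]] //.
move=> /hull4P [w1 [w2 [w3 [w4 [[? ? ? ?] sw yE]]]]].
by case: e => [|[|[|[|[|e]]]]]; apply/hull4P;
  [exists w1, w2, w3, w4 | exists w1, w3, w2, w4 | exists w1, w4, w2, w3
  | exists w2, w3, w1, w4 | exists w2, w4, w1, w3 | exists w3, w4, w1, w2];
  split=> //; try lra; move=> r; rewrite yE; ring.
Qed.

Lemma hull_cut e i j X A B y : Z.lt Z0 i -> Z.lt Z0 j ->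
  cut e i j X = Some (A, B) -> hull X y -> hull A y \/ hull B y.
Proof.
move=> /(of_Z_lt R); rewrite of_Z0 => i0 /(of_Z_lt R); rewrite of_Z0 => j0.
rewrite /cut => cutE /(hull_edge_order e); move: cutE.
case: (edge_order e X) => [|P [|Q [|S [|T [|? ?]]]]] //.
move: (point_div _ _) => m; case: point_eqbP => // mE [<- <-].
have {mE}mE r : (zr i + zr j) * coord R r m =
    zr i * coord R r P + zr j * coord R r Q.
  have := congr1 (fun v => coord R r v) mE; rewrite /coord.
  move: m P Q {mE} => [[m1 m2] m3] [[p1 p2] p3] [[q1 q2] q3].
  by case: r; rewrite /= ?of_ZN !(of_ZM, of_ZD) => E; lra.
move=> /hull4P [w1 [w2 [w3 [w4 [[w1_ge w2_ge w3_ge w4_ge] sw yE]]]]].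
have i0' : zr i != 0 by rewrite gt_eqF.
have j0' : zr j != 0 by rewrite gt_eqF.
have ij0 : zr i + zr j != 0 by rewrite gt_eqF ?addr_gt0.
have {}mE r : coord R r m = (zr i * coord R r P + zr j * coord R r Q) / (zr i + zr j).
  by rewrite -mE mulrAC divff // mul1r.
(* The ratio of w1 to w2 against i to j decides the side. In the first case the whole weight of Q
   passes to the dividing point, which consumes w2 i / j of the weight of P; the second case is
   symmetric. *)
have [le|lt] := lerP (w2 * zr i) (w1 * zr j); [left | right]; apply/hull4P.
- exists (w1 - w2 * zr i / zr j), (w2 * (zr i + zr j) / zr j), w3, w4; split.
  + split=> //; first by rewrite subr_ge0 ler_pdivrMr.
    by rewrite divr_ge0 ?mulr_ge0 ?addr_ge0 // ltW.
  + by rewrite -sw; field.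
  + by move=> r; rewrite yE mE; field; rewrite ij0 j0'.
- exists (w1 * (zr i + zr j) / zr i), (w2 - w1 * zr j / zr i), w3, w4; split.
  + split=> //; last by rewrite subr_ge0 ler_pdivrMr // ltW.
    by rewrite divr_ge0 ?mulr_ge0 ?addr_ge0 // ltW.
  + by rewrite -sw; field.
  + by move=> r; rewrite yE mE; field; rewrite ij0 i0'.
Qed.

Lemma survivorsP d C (ks : seq opforms) X y p : hull C p -> hull X y ->
  (forall k, k \in ks -> exists2 h, k = mkforms C h & 0 < gap h y p) ->
  exists2 X', X' \in survivors d ks X & hull X' y.
Proof.
move=> Cp; elim: d X ks => [|d IH] X ks Xy ksP /=; rewrite lazy_hasE.
all: case: hasP => [[e /mapP [k kks ->] /=]|_].
- rewrite lazy_allE => vn; have [h kE hpos] := ksP k kks.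
  have [W Ww gE] := gap_hull Xy Cp.
  move: hpos; rewrite gE ltNge; case/negP; apply: wsum_le0 Ww _ _.
    by rewrite size_values.
  by rewrite -kE.
- by exists X; rewrite ?inE.
- rewrite lazy_allE => vn; have [h kE hpos] := ksP k kks.
  have [W Ww gE] := gap_hull Xy Cp.
  move: hpos; rewrite gE ltNge; case/negP; apply: wsum_le0 Ww _ _.
    by rewrite size_values.
  by rewrite -kE.
- case E : (cut _ _ _ X) => [[A B]|]; last by exists X; rewrite ?inE.
  have ksP' k : k \in [seq e.1 | e <- [seq e <- [seq (k, values k X) | k <- ks]
      | lazy_has nonpos e.2]] -> exists2 h, k = mkforms C h & 0 < gap h y p.
    by move=> /mapP [e]; rewrite mem_filter => /andP [_ /mapP [k' k'ks ->]] ->; apply: ksP.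
  have [Ay|By] := hull_cut (Z.lt_0_1) (Z.lt_0_1) E Xy.
    by have [X' X'in] := IH A _ Ay ksP'; exists X'; rewrite // mem_cat X'in.
  by have [X' X'in] := IH B _ By ksP'; exists X'; rewrite // mem_cat X'in orbT.
Qed.

End Subdivision.

(** * Ranges of coordinates and distances over a hull *)

Section Bounds.
Variable R : realFieldType.
Local Open Scope ring_scope.
Local Notation zr := (@of_Z R).
Implicit Types (w : seq R) (h g : op) (y p : triple R) (X C : seq point).

Lemma range_bounds (l : seq Z) z : z \in l ->
  Z.le (extent l).1 z /\ Z.le z (extent l).2.
Proof.
case: l => // a l; rewrite inE => zl; rewrite /extent.
have : Z.le (a, a).1 z /\ Z.le z (a, a).2 \/ z \in l.
  by case/predU1P: zl => [->|]; [left; split; apply: Z.le_refl | right].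
move: (a, a) => {zl} m; elim: l m => [|b l IH] m /=; first by case.
move=> H; apply: IH => /=; case: H => [[H1 H2]|]; first by left; lia.
by rewrite inE => /predU1P [->|]; [left; lia | right].
Qed.

Lemma range_hull (l C : seq point) r y : hull C y -> {subset C <= l} ->
  zr (extent (map (row_apply Z.opp r) l)).1 <= row_apply -%R r y <=
  zr (extent (map (row_apply Z.opp r) l)).2.
Proof.
move=> [w ww ->] Cl.
have yE : row_apply -%R r (comb w C) = wsum w (map zr (map (row_apply Z.opp r) C)).
  case: ww => sw _ _; rewrite -map_comp /comb.
  have opp s s' : (forall v, row_apply Z.opp s' v = Z.opp (row_apply Z.opp s v)) ->
      - wsum w [seq coord R s v | v <- C] = wsum w [seq coord R s' v | v <- C].
    move=> ss'; elim: (w) C {Cl sw} => [|x u IH] [|c C] /=; rewrite ?oppr0 //.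
    by rewrite opprD IH /coord ss' of_ZN mulrN.
  by case: r => /=; rewrite ?(opp PX NX) ?(opp PY NY) ?(opp PZ NZ) //; case=> -[].
have rl c : c \in C -> row_apply Z.opp r c \in map (row_apply Z.opp r) l.
  by move=> cC; apply: map_f; apply: Cl.
rewrite {}yE; apply/andP; split.
  apply: wsum_ge ww _ _; rewrite ?size_map //.
  apply/allP => z /mapP [c cC ->]; have [] := range_bounds (rl c cC).
  by move=> /Z.leb_le.
set k := (extent _).2.
have <- : wsum w (nseq (size C) (zr k)) = zr k := wsum_const _ ww.
rewrite -map_nseq; apply: wsum_le ww _ _ _; rewrite ?size_map ?size_nseq //.
elim: (C) rl => //= c C' IH rl.
have [_ /Z.leb_le ->] := range_bounds (rl c (mem_head _ _)).
by apply: IH => v vC; apply: rl; rewrite inE vC orbT.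
Qed.

Lemma tdistC y p : tdist y p = tdist p y.
Proof.
by move: y p => [[y1 y2] y3] [[p1 p2] p3]; rewrite /tdist /=; ring.
Qed.

Lemma tdist_ge0 y p : 0 <= tdist y p.
Proof.
by move: y p => [[y1 y2] y3] [[p1 p2] p3]; rewrite /tdist /= -!expr2 !addr_ge0 ?sqr_ge0.
Qed.

(** The function v |-> |v - p|^2 - |v - y|^2 is affine with value |y - p|^2 at y, so |y - p|^2 is
    its weighted mean over the vertices, where it is at most |v - p|^2. *)
Lemma tdist_hull X y p (K : R) : hull X y ->
  (forall v, v \in X -> tdist (of_point R v) p <= K) -> tdist y p <= K.
Proof.
move=> [w ww yE] XK; case: (ww) => sw w0 w1.
case: y p yE XK => -[y1 y2] y3 [[p1 p2] p3] yE XK.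
pose n := p1 ^+ 2 + p2 ^+ 2 + p3 ^+ 2 - (y1 ^+ 2 + y2 ^+ 2 + y3 ^+ 2).
have := wsum_affine n (2 * (p1 - y1)) (2 * (p2 - y2)) (2 * (p3 - y3)) sw.
rewrite w1 mul1r -yE /= => E.
have dE : tdist (y1, y2, y3) (p1, p2, p3) = wsum w
   [seq tdist (of_point R v) (p1, p2, p3) - tdist (of_point R v) (y1, y2, y3) | v <- X].
  rewrite (@eq_map _ _ _ (fun v => n - (2 * (p1 - y1) * coord R PX v +
     2 * (p2 - y2) * coord R PY v + 2 * (p3 - y3) * coord R PZ v))).
    by rewrite -E /n /tdist /=; ring.
  by move=> -[[v1 v2] v3]; rewrite /n /tdist /coord /=; ring.
rewrite dE -(wsum_const K ww) -sw.
elim: (w) X w0 XK {ww yE w1 E dE} sw => [|a u IH] [|v X] //= /andP [a0 u0] XK [su].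
rewrite lerD //; last by apply: IH => // v' v'X; apply: XK; rewrite inE v'X orbT.
rewrite ler_wpM2l // lerBlDr (le_trans (XK v _)) ?mem_head //.
by rewrite lerDl tdist_ge0.
Qed.

Lemma mem_zrange n a k : Z.le a k -> Z.lt k (Z.add a (Z.of_nat n)) -> k \in zrange n a.
Proof.
elim: n a => [|n IH] a; first by lia.
move=> ak kn /=; rewrite inE; case: (Z.eq_dec k a) => [->|ka]; first by rewrite eqxx.
by rewrite IH ?orbT //; lia.
Qed.

Lemma mem_shifts S B r m tau k (x q : R) (t := Z.mul S (Z.add tau (Z.mul (Zpos 4) k))) :
  Z.lt Z0 S -> zr B.1 <= x -> x <= zr B.2 -> `|x - (q + zr t)| <= zr r ->
  zr m.1 <= q -> q <= zr m.2 ->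
  exists2 gg, (t, gg) \in shifts S B r m tau & zr gg <= (x - (q + zr t)) ^+ 2.
Proof.
move=> S0 Bx xB; rewrite ler_norml => /andP [xl xr] mq qm; rewrite /shifts.
set lo := Z.opp _; set hi := Z.div _ _.
set gg := (X in map X _).
(* The negated floor in [lo] is a ceiling: [lo] is the least k with m.2 + t at least B.1 - r, and
   [hi] the greatest with m.1 + t at most B.2 + r. *)
have lok : Z.le lo k.
  have : Z.le (Z.sub (Z.sub B.1 r) m.2) t.
    by apply: (@of_Z_leE R); rewrite !of_ZB; lra.
  rewrite /t /lo => H; apply/Z.opp_le_mono; rewrite Z.opp_involutive.
  by apply: Z.div_le_lower_bound; nia.
have khi : Z.le k hi.
  have : Z.le t (Z.sub (Z.add B.2 r) m.1).
    by apply: (@of_Z_leE R); rewrite of_ZB of_ZD; lra.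
  by rewrite /t /hi => H; apply: Z.div_le_lower_bound; nia.
exists (gg k).2.
  rewrite [X in X \in _](_ : _ = gg k) //; apply: map_f.
  by apply: mem_zrange => //; lia.
rewrite /gg /= -/t of_ZM -expr2.
set u := Z.max _ _.
have u0 : 0 <= zr u by rewrite -(of_Z0 R); apply: of_Z_le; rewrite /u; lia.
have ul : zr u <= `|x - (q + zr t)|.
  have [->|[->|->]] : u = Z0 \/ u = Z.sub (Z.add m.1 t) B.2 \/ u = Z.sub (Z.sub B.1 m.2) t.
  - by rewrite /u; lia.
  - exact: normr_ge0.
  - by rewrite of_ZB of_ZD -normrN; apply: le_trans _ (ler_norm _); lra.
  - by rewrite !of_ZB; apply: le_trans _ (ler_norm _); lra.
by rewrite -(real_normK (num_real (x - _))) lerXn2r // nnegrE.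
Qed.

End Bounds.

(** The list GL gives translations in quarters of the cell side; in the finer unit of the
    computation they are S times as large. *)
Definition member (GL : seq op) (S : Z) (g : op) : Prop :=
  exists M t, g = (M, pscale S t) /\ op_red (M, t) \in GL.

Lemma sqrt_up_spec n (r := Z.add (Z.sqrt n) (Zpos 1)) :
  Z.lt Z0 n -> Z.le Z0 r /\ Z.le n (Z.mul r r).
Proof.
move=> n0; have := Z.sqrt_spec n (Z.lt_le_incl _ _ n0).
by have := Z.sqrt_nonneg n; rewrite /r; lia.
Qed.

(** * Completeness and soundness of the list of candidates *)

Section Candidates.
Variable R : realFieldType.
Local Open Scope ring_scope.
Local Notation zr := (@of_Z R).
Implicit Types (w : seq R) (h g : op) (y p : triple R) (X C : seq point).

Definition in_box (B : triple (Z * Z)) y : Prop :=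
  [/\ zr B.1.1.1 <= y.1.1 <= zr B.1.1.2, zr B.1.2.1 <= y.1.2 <= zr B.1.2.2 &
      zr B.2.1 <= y.2 <= zr B.2.2].

Lemma in_box_hull X (l : seq point) y : hull X y -> {subset X <= l} ->
  in_box (box l) y.
Proof.
case: y => -[y1 y2] y3 Xy Xl.
have rg r := range_hull r Xy Xl.
by split; [exact: (rg PX) | exact: (rg PY) | exact: (rg PZ)].
Qed.

Lemma mem_candidates S GL C B rho g y p : Z.lt Z0 S -> member GL S g ->
  g != op_id -> hull C p -> in_box B y -> tdist y (op_apply g p) < zr rho ->
  g \in candidates S GL C B rho.
Proof.
move=> S0 [[[a b] c] [[[t1 t2] t3] [-> gGL]]] gid Cp yB dg.
have mod4 t : t = Z.add (Z.modulo t (Zpos 4)) (Z.mul (Zpos 4) (Z.div t (Zpos 4))).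
  by rewrite Z.add_comm; apply: Z.div_mod.
apply/flatten_mapP; exists (op_red (a, b, c, (t1, t2, t3))) => //.
set r := Z.add _ _.
move: dg yB; rewrite /op_apply /candidates_of [op_red _]/=.
(* Candidates are enumerated as S (tau + 4 k) with tau the residue stored in GL, so each translation
   is first brought to that shape. *)
rewrite [pscale _ _]/= [in tdist _ _](mod4 t1) [in tdist _ _](mod4 t2) [in tdist _ _](mod4 t3).
set k1 := Z.div t1 _; set k2 := Z.div t2 _; set k3 := Z.div t3 _.
move: y B => [[y1 y2] y3] [[B1 B2] B3] dg [] /= /andP [y1l y1u] /andP [y2l y2u] /andP [y3l y3u].
have rg s := range_hull s Cp (fun x (xC : x \in C) => xC).
have /andP [al au] := rg a; have /andP [bl bu] := rg b; have /andP [cl cu] := rg c.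
have E : (row_apply -%R a p, row_apply -%R b p, row_apply -%R c p) =
  rows_apply -%R (a, b, c) p by [].
move: dg; rewrite -E /tdist /= -!expr2.
set T1 := Z.mul S (Z.add (Z.modulo t1 _) _).
set T2 := Z.mul S (Z.add (Z.modulo t2 _) _).
set T3 := Z.mul S (Z.add (Z.modulo t3 _) _).
set d1 := y1 - _; set d2 := y2 - _; set d3 := y3 - _ => dlt.
have d1_ge := sqr_ge0 d1; have d2_ge := sqr_ge0 d2; have d3_ge := sqr_ge0 d3.
have rho0 : Z.lt Z0 rho.
  by apply: (@of_Z_ltE R); rewrite of_Z0; apply: le_lt_trans dlt; rewrite !addr_ge0.
have [/(of_Z_le R) r0 /(of_Z_le R)] := sqrt_up_spec rho0.
rewrite of_ZM -expr2 => rr.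
have small d : d ^+ 2 <= d1 ^+ 2 + d2 ^+ 2 + d3 ^+ 2 -> `|d| <= zr r.
  move=> dle; rewrite -(@ler_pXn2r _ 2) ?nnegrE //.
  by rewrite real_normK ?num_real //; apply: le_trans dle (le_trans (ltW dlt) rr).
have [g1 g1in g1le] : exists2 gg, (T1, gg) \in shifts S B1 r
     (extent (map (row_apply Z.opp a) C)) (Z.modulo t1 (Zpos 4)) & zr gg <= d1 ^+ 2.
  apply: mem_shifts => //; apply: small.
  by rewrite -addrA lerDl addr_ge0.
have [g2 g2in g2le] : exists2 gg, (T2, gg) \in shifts S B2 r
     (extent (map (row_apply Z.opp b) C)) (Z.modulo t2 (Zpos 4)) & zr gg <= d2 ^+ 2.
  apply: mem_shifts => //; apply: small.
  by rewrite addrAC lerDr addr_ge0.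
have [g3 g3in g3le] : exists2 gg, (T3, gg) \in shifts S B3 r
     (extent (map (row_apply Z.opp c) C)) (Z.modulo t3 (Zpos 4)) & zr gg <= d3 ^+ 2.
  apply: mem_shifts => //; apply: small.
  by rewrite lerDr addr_ge0.
have TE (t : Z) : Z.mul S t = Z.mul S (Z.add (Z.modulo t (Zpos 4)) (Z.mul (Zpos 4) (Z.div t (Zpos 4)))).
  by rewrite -mod4.
apply/flatten_mapP; exists (T1, g1) => //.
apply/flatten_mapP; exists (T2, g2) => //=.
case: Z.ltb_spec => [/(of_Z_lt R)|_]; first by rewrite of_ZD ltNge (le_trans _ (ltW dlt)) //; rewrite (le_trans (lerD g1le g2le)) // lerDl.
apply/flatten_mapP; exists (T3, g3) => //=.
case: Z.ltb_spec => [/(of_Z_lt R)|_]; first by rewrite !of_ZD ltNge (le_trans (lerD (lerD g1le g2le) g3le)) // ltW.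
move: gid; rewrite /= (TE t1) (TE t2) (TE t3) -/k1 -/k2 -/k3 -/T1 -/T2 -/T3.
by rewrite -op_eqbE; case: ifP => [H /negP [] //|_ _]; rewrite mem_head.
Qed.

(** Only nontrivial elements of the group are legitimate competitors: the assumption on y in
    [few_neighbours] is available for those alone. *)
Lemma candidates_member S GL C B rho h :
  {in GL, forall g, op_red g = g} ->
  h \in candidates S GL C B rho -> member GL S h /\ h != op_id.
Proof.
move=> GLred /flatten_mapP [[[[a b] c] [[t1 t2] t3]] gGL].
case: B => -[B1 B2] B3 /flatten_mapP [[T1 g1] /mapP [k1 _ [-> ->]]].
move=> /flatten_mapP [[T2 g2] /mapP [k2 _ [-> ->]]] /=; case: ifP => // _.
move=> /flatten_mapP [[T3 g3] /mapP [k3 _ [-> ->]]]; case: ifP => // _.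
case: ifP => // /negbT hid; rewrite inE => /eqP ->; split; last by rewrite -op_eqbE.
exists (a, b, c), (Z.add t1 (Z.mul (Zpos 4) k1), Z.add t2 (Z.mul (Zpos 4) k2), Z.add t3 (Z.mul (Zpos 4) k3)).
split=> //; have := GLred _ gGL; rewrite /op_red => -[E1 E2 E3].
have M t k : Z.modulo t (Zpos 4) = t -> Z.modulo (Z.add t (Z.mul (Zpos 4) k)) (Zpos 4) = t.
  by move=> tE; rewrite Z.mul_comm Z_mod_plus_full.
by rewrite (M _ _ E1) (M _ _ E2) (M _ _ E3).
Qed.

End Candidates.

Lemma mem_insert (e : Z * entry) l : insert e l =i e :: l.
Proof.
elim: l => //= a l IH x; case: ifP => // _.
by rewrite inE IH !inE orbCA.
Qed.

Lemma mem_table (ks : seq opforms) X e :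
  (e \in table ks X) =
  (lazy_has nonpos e.2 && (e \in [seq (k, values k X) | k <- ks])).
Proof.
transitivity (e \in [seq f <- [seq (k, values k X) | k <- ks] | lazy_has nonpos f.2]).
  rewrite /table; elim: (seq.filter _ _) => //= a l IH.
  apply/mapP/idP => [[z]|].
    rewrite mem_insert inE => /predU1P [-> ->|zl ez]; first by rewrite mem_head.
    by rewrite inE -IH ez (map_f snd zl) orbT.
  rewrite inE => /predU1P [->|el].
    by exists (total a, a); rewrite ?mem_insert ?mem_head.
  rewrite -IH in el; have /mapP [z zl ez] := el.
  by exists z; rewrite ?mem_insert // inE zl orbT.
by rewrite mem_filter.
Qed.

Lemma scan_acc tb l acc : {subset acc <= scan tb l acc}.
Proof.
elim: l acc => [|e l IH] acc x xa //=; apply: IH; case: ifP => // _.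
by case: ifP => // _; rewrite inE xa orbT.
Qed.

Lemma mem_scan tb l acc e : e \in l -> ~~ excluded tb e ->
  e.1.1 \in scan tb l acc.
Proof.
elim: l acc => //= a l IH acc; rewrite inE => /predU1P [<-|el] ne; last exact: IH.
apply: scan_acc; rewrite op_memE; case: ifP => // _.
by rewrite (negPf ne) mem_head.
Qed.

Lemma neighbours_acc ks U acc : {subset acc <= neighbours ks U acc}.
Proof.
elim: U acc => [|X U IH] acc x xa //=; apply: IH; exact: scan_acc.
Qed.

Lemma mem_neighbours ks U acc X e : X \in U -> e \in table ks X ->
  ~~ excluded (table ks X) e -> e.1.1 \in neighbours ks U acc.
Proof.
elim: U acc => //= X' U IH acc; rewrite inE => /predU1P [<-|XU] et ne.
  by apply: neighbours_acc; apply: mem_scan.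
exact: IH.
Qed.

(** * Soundness of the certificate *)

Section Certificates.
Variable R : realFieldType.
Local Open Scope ring_scope.
Local Notation zr := (@of_Z R).
Implicit Types (w : seq R) (h g : op) (y p : triple R) (X C : seq point).

Lemma not_excluded C X (ks : seq op) g y p :
  hull X y -> hull C p -> 0 < gap g y p ->
  (forall h, h \in ks -> h != g -> gap g y p < gap h y p) ->
  ~~ excluded (table (map (mkforms C) ks) X) (mkforms C g, values (mkforms C g) X).
Proof.
move=> Xy Cp g0 gks; have [W Ww gE] := gap_hull Xy Cp.
have tbP e : e \in table (map (mkforms C) ks) X -> exists2 h, h \in ks &
    e = (mkforms C h, values (mkforms C h) X).
  rewrite mem_table => /andP [_ /mapP [k /mapP [h hks ->] ->]].
  by exists h.
have vs h := size_values X C h.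
rewrite /excluded /= lazy_allE; case: ifP => [vn|_].
  by move: g0; rewrite gE ltNge (wsum_le0 Ww).
case: ifP => [|_].
  rewrite /dominated lazy_hasE => /hasP [e /tbP [h hks ->]] /=.
  case: ifP => // le; rewrite op_eqbE eq_sym => /(gks h hks).
  by rewrite !gE ltNge (wsum_le Ww).
have : {subset take 40 (table (map (mkforms C) ks) X) <= table (map (mkforms C) ks) X}.
  by move=> e; apply: mem_take.
elim: (take _ _) => //= k l IH sub; rewrite lazy_hasE; case: ifP => [|_]; last first.
  by apply: IH => e el; apply: sub; rewrite inE el orbT.
move=> /hasP [k' k'l]; have [h hks ->] := tbP _ (sub k (mem_head _ _)).
have [h' h'ks ->] : exists2 h, h \in ks & k' = (mkforms C h, values (mkforms C h) X).
  by apply: tbP; apply: sub; rewrite inE k'l orbT.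
case: ifP => //= le; rewrite !op_eqbE; case: eqP => // /eqP hg.
rewrite eq_sym => /(gks h' h'ks) lt'; rewrite eq_sym in hg; have := gks h hks hg.
(* Both competitors exceed f_g at (y, p), so their sum exceeds 2 f_g, which is more than f_g because
   f_g is positive there. *)
have := wsum_sum_le Ww (vs h) (vs h') (vs g) le; move: g0 lt'; rewrite !gE; lra.
Qed.

(** If w1, w2, w3 are s, t, u in decreasing order, the barycentric coordinates are 1 - w1, w1 - w2,
    w2 - w3, w3. *)
Lemma kuhn_hull (a b c : Z) (s t u : R) :
  0 <= s <= 1 -> 0 <= t <= 1 -> 0 <= u <= 1 ->
  exists2 X, X \in kuhn a b c & hull X (s * zr a, t * zr b, u * zr c).
Proof.
move=> /andP [s0 s1] /andP [t0 t1] /andP [u0 u1].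
have sol X (w1 w2 w3 : R) : X \in kuhn a b c ->
    (forall r, row_apply -%R r (s * zr a, t * zr b, u * zr c) =
       (1 - w1) * coord R r (nth (Z0, Z0, Z0) X 0) + (w1 - w2) * coord R r (nth (Z0, Z0, Z0) X 1)
       + (w2 - w3) * coord R r (nth (Z0, Z0, Z0) X 2) + w3 * coord R r (nth (Z0, Z0, Z0) X 3)) ->
    w1 <= 1 -> w2 <= w1 -> w3 <= w2 -> 0 <= w3 -> size X = 4%N ->
    exists2 X, X \in kuhn a b c & hull X (s * zr a, t * zr b, u * zr c).
  move=> Xin yE w11 w21 w32 w30 sX; exists X => //.
  move: X sX yE {Xin} => [|A [|B [|D [|F []]]]] // _ yE; apply/hull4P.
  exists (1 - w1), (w1 - w2), (w2 - w3), w3; split=> //; last by ring.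
  by rewrite !subr_ge0.
(* Two of the eight sign patterns are cyclic and contradictory; the other six are the six orders. *)
have [st|ts] := lerP s t; have [tu|ut] := lerP t u; have [su|us] := lerP s u; try lra.
- apply: (sol [:: (Z0, Z0, Z0); (Z0, Z0, c); (Z0, b, c); (a, b, c)] u t s) => //.
    by rewrite !inE eqxx ?orbT.
  by case; rewrite /coord /= ?of_ZN ?of_Z0; ring.
- apply: (sol [:: (Z0, Z0, Z0); (Z0, b, Z0); (Z0, b, c); (a, b, c)] t u s) => //;
    rewrite ?(ltW ut) //.
    by rewrite !inE eqxx ?orbT.
  by case; rewrite /coord /= ?of_ZN ?of_Z0; ring.
- apply: (sol [:: (Z0, Z0, Z0); (Z0, b, Z0); (a, b, Z0); (a, b, c)] t s u) => //;
    rewrite ?(ltW us) //.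
    by rewrite !inE eqxx ?orbT.
  by case; rewrite /coord /= ?of_ZN ?of_Z0; ring.
- apply: (sol [:: (Z0, Z0, Z0); (Z0, Z0, c); (a, Z0, c); (a, b, c)] u s t) => //;
    rewrite ?(ltW ts) //.
    by rewrite !inE eqxx ?orbT.
  by case; rewrite /coord /= ?of_ZN ?of_Z0; ring.
- apply: (sol [:: (Z0, Z0, Z0); (a, Z0, Z0); (a, Z0, c); (a, b, c)] s u t) => //;
    rewrite ?(ltW us) //.
    by rewrite !inE eqxx ?orbT.
  by case; rewrite /coord /= ?of_ZN ?of_Z0; ring.
- apply: (sol [:: (Z0, Z0, Z0); (a, Z0, Z0); (a, b, Z0); (a, b, c)] s t u) => //;
    rewrite ?(ltW ut) ?(ltW ts) //.
    by rewrite !inE eqxx ?orbT.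
  by case; rewrite /coord /= ?of_ZN ?of_Z0; ring.
Qed.

Definition in_cube (k : R) y : Prop :=
  [/\ `|y.1.1| <= k, `|y.1.2| <= k & `|y.2| <= k].

Lemma big_cube_hull u y : Z.lt Z0 u -> in_cube (zr u) y ->
  exists2 X, X \in big_cube u & hull X y.
Proof.
move=> /(of_Z_lt R); rewrite of_Z0 => u0; case: y => -[y1 y2] y3 [/= h1 h2 h3].
have side z : `|z| <= zr u -> exists2 a, a \in [:: u; Z.opp u] &
    exists2 s, 0 <= s <= 1 & z = s * zr a.
  move=> zu; have [z0|z0] := lerP 0 z.
    exists u; rewrite ?mem_head //; exists (z / zr u).
      by rewrite divr_ge0 ?(ltW u0) // ler_pdivrMr // mul1r; move: zu; rewrite ger0_norm.
    by rewrite divfK // gt_eqF.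
  exists (Z.opp u); rewrite ?inE ?eqxx ?orbT //; exists (- z / zr u).
    rewrite divr_ge0 ?(ltW u0) ?oppr_ge0 ?(ltW z0) // ler_pdivrMr // mul1r.
    by move: zu; rewrite ltr0_norm.
  by rewrite of_ZN mulrN divfK ?gt_eqF // opprK.
have [a ain [s s01 ->]] := side _ h1; have [b bin [t t01 ->]] := side _ h2.
have [c cin [v v01 ->]] := side _ h3.
have [X Xin yX] := kuhn_hull a b c s01 t01 v01; exists X => //.
apply/flatten_mapP; exists a => //; apply/flatten_mapP; exists b => //.
by apply/flatten_mapP; exists c.
Qed.

Lemma foldl_max_ge (l : seq Z) m z : z \in m :: l -> Z.le z (foldl Z.max m l).
Proof.
elim: l m z => [|a l IH] m z /=; first by rewrite inE => /eqP ->; apply: Z.le_refl.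
rewrite !inE => /or3P [/eqP ->|/eqP ->|zl].
- by apply: Z.le_trans (IH _ _ (mem_head _ _)); lia.
- by apply: Z.le_trans (IH _ _ (mem_head _ _)); lia.
- by apply: IH; rewrite inE zl orbT.
Qed.

Lemma pdistE (u v : point) : zr (pdist u v) = tdist (of_point R u) (of_point R v).
Proof.
by move: u v => [[u1 u2] u3] [[v1 v2] v3]; rewrite /pdist /= !(of_ZD, of_ZM, of_ZB).
Qed.

(* In the application y lies close to a facet of the cell of p, at a distance
   that can only be chosen once the finite set K of competitors is known. *)
Definition few_neighbours (GL : seq op) (S : Z) (n : nat) p : Prop :=
  exists L K : seq op, [/\ (size L <= n)%N,
    forall h, h \in K -> member GL S h /\ h != op_id &
    forall g y, member GL S g -> g != op_id -> in_cube (zr (Z.mul (Zpos 4) S)) y ->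
      0 < gap g y p < 1 -> (forall h, h \in K -> h != g -> gap g y p < gap h y p) ->
      g \in L].

Lemma cell_okP S GL n kappa d C p : Z.lt Z0 S ->
  {in GL, forall g, op_red g = g} -> {in GL, forall g, orthogonal_rows g.1} ->
  hull C p -> cell_ok S GL n kappa d C -> few_neighbours GL S n p.
Proof.
move=> S0 GLred GLorth Cp; rewrite /cell_ok.
set K1 := candidates S GL C (box C) kappa; set U := flatten (map (survivors d _) _).
set rho := Z.add _ _; set K2 := candidates S GL C _ rho; set ks := seq.filter _ _ => sL.
exists (neighbours ks U [::]), (K1 ++ K2); split=> //.
  by move=> h; rewrite mem_cat => /orP []; apply: candidates_member.
move=> g y gm gid ycube /andP [g0 g1] gK.
(* The case h = g is included, so g itself may be among the competitors that discard simplices. *)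
have gpos h : h \in K1 ++ K2 -> 0 < gap h y p.
  move=> hK; case: (eqVneq h g) => [->//|hg]; apply: lt_trans g0 _; exact: gK.
have [X0 X0in yX0] : exists2 X, X \in big_cube (Z.mul (Zpos 4) S) & hull X y.
  by apply: big_cube_hull => //; lia.
have [|X Xin yX] := @survivorsP _ d C [seq mkforms C h | h <- K1] X0 y p Cp yX0.
  by move=> k /mapP [h hK ->]; exists h => //; apply: gpos; rewrite mem_cat hK.
have XU : X \in U by apply/flatten_mapP; exists X0.
have Xsub : {subset X <= flatten U}.
  by move=> v vX; apply/flattenP; exists X.
have gorth : orthogonal_rows g.1.
  by case: gm => M [[[t1 t2] t3] [-> tGL]]; exact: GLorth tGL.
have dyp : tdist y p <= zr (Z.sub rho (Zpos 1)).
  apply: tdist_hull yX _ => v vX; rewrite tdistC.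
  apply: tdist_hull Cp _ => c cC; rewrite -pdistE; apply: of_Z_le.
  rewrite /rho; have -> : pdist c v = pdist v c.
    by move: (c) (v) => [[? ?] ?] [[? ?] ?]; rewrite /pdist /=; lia.
  set F := flatten _; have : pdist v c \in Z0 :: F.
    rewrite inE; apply/orP; right; apply/flatten_mapP; exists v; first exact: Xsub.
    exact: map_f.
  by move/foldl_max_ge; lia.
have gK2 : g \in K2.
  apply: mem_candidates Cp (in_box_hull yX Xsub) _ => //.
  have := gapE y p gorth; move: g1 dyp; rewrite of_ZB of_Z1; lra.
(* The vertex values are integers: were none of them nonpositive, all would be at least 1, and so
   would f_g(y, p). *)
have [W Ww gE] := gap_hull yX Cp.
have vpos : has nonpos (values (mkforms C g) X).
  apply: contraLR g1; rewrite -leNgt -(of_Z1 R) gE => /hasPn vn.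
  apply: wsum_ge Ww _ _; first by rewrite size_values.
  by apply/allP => z /vn; rewrite /nonpos; lia.
have gks : mkforms C g \in ks.
  rewrite mem_filter map_f // andbT lazy_hasE; apply/hasP.
  have [z /flatten_mapP [v vX /mapP [f fk ->]] zn] := hasP vpos.
  by exists v; [exact: Xsub | rewrite lazy_hasE; apply/hasP; exists f].
pose hs := [seq h <- K2 | has (fun x => has (fun f => nonpos (form_eval f x)) (mkforms C h).2) (flatten U)].
have ksE : ks = map (mkforms C) hs.
  rewrite /ks /hs filter_map; congr map; apply: eq_filter => h /=.
  by rewrite lazy_hasE; apply: eq_has => x; rewrite lazy_hasE.
have etb : (mkforms C g, values (mkforms C g) X) \in table ks X.
  by rewrite mem_table lazy_hasE vpos /=; apply: map_f gks.
rewrite -[g]/((mkforms C g, values (mkforms C g) X).1.1).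
apply: mem_neighbours XU etb _; rewrite ksE.
apply: not_excluded yX Cp g0 _ => h; rewrite mem_filter => /andP [_ hK2] hg.
by apply: gK; rewrite // mem_cat hK2 orbT.
Qed.

Lemma plan_okP S GL n pl C p : Z.lt Z0 S ->
  {in GL, forall g, op_red g = g} -> {in GL, forall g, orthogonal_rows g.1} ->
  hull C p -> plan_ok S GL n pl C -> few_neighbours GL S n p.
Proof.
move=> S0 GLred GLorth; elim: pl C => [kappa d|e i j pl1 IH1 pl2 IH2] C Cp /=.
  exact: cell_okP.
case: Z.ltb_spec => // i0; case: Z.ltb_spec => // j0.
case E : cut => [[A B]|] //; case: ifP => // ok1 ok2.
by have [/IH1|/IH2] := hull_cut i0 j0 E Cp; apply.
Qed.

End Certificates.

(** * Facets of a finite intersection of half-spaces *)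

Section Facets.
Variable R : realType.
Local Open Scope classical_set_scope.
Local Open Scope ring_scope.
Local Notation E := 'rV[R]_3.
Implicit Types (u v w x y : E).

Lemma dotvE u v : dotv u v = (u *m v^T) 0 0.
Proof. by rewrite mxE; apply: eq_bigr => i _; rewrite mxE. Qed.

Lemma dotvC u v : dotv u v = dotv v u.
Proof. by apply: eq_bigr => i _; rewrite mulrC. Qed.

Lemma dotvDr u v w : dotv u (v + w) = dotv u v + dotv u w.
Proof. by rewrite -big_split; apply: eq_bigr => i _; rewrite mxE mulrDr. Qed.

Lemma dotvZr (a : R) u v : dotv u (a *: v) = a * dotv u v.
Proof. by rewrite mulr_sumr; apply: eq_bigr => i _; rewrite mxE mulrCA. Qed.

Lemma dotvNr u v : dotv u (- v) = - dotv u v.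
Proof. by rewrite -scaleN1r dotvZr mulN1r. Qed.

Lemma dotvBr u v w : dotv u (v - w) = dotv u v - dotv u w.
Proof. by rewrite dotvDr dotvNr. Qed.

Lemma dotvDl u v w : dotv (u + v) w = dotv u w + dotv v w.
Proof. by rewrite !(dotvC _ w) dotvDr. Qed.

Lemma dotvBl u v w : dotv (u - v) w = dotv u w - dotv v w.
Proof. by rewrite !(dotvC _ w) dotvBr. Qed.

Lemma dotvZl (a : R) u v : dotv (a *: u) v = a * dotv u v.
Proof. by rewrite !(dotvC _ v) dotvZr. Qed.

Lemma dotv0r u : dotv u 0 = 0.
Proof. by rewrite -(subrr 0) dotvBr subrr. Qed.

Lemma dotv_ge0 u : 0 <= dotv u u.
Proof. by apply: sumr_ge0 => i _; rewrite -expr2 sqr_ge0. Qed.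

Lemma dotv_eq0 u : (dotv u u == 0) = (u == 0).
Proof.
apply/eqP/eqP => [|->]; last exact: dotv0r.
move=> /eqP; rewrite psumr_eq0; last by move=> i _; rewrite -expr2 sqr_ge0.
move=> /allP u0; apply/rowP => i; rewrite mxE; apply/eqP.
by have := u0 i (mem_index_enum _); rewrite mulf_eq0 orbb.
Qed.

Definition orth u : {vspace E} := lker (linfun (mulmxr u^T : E -> 'rV[R]_1)).

Lemma mem_orth u v : (v \in orth u) = (dotv u v == 0).
Proof.
rewrite memv_ker lfunE /= dotvC dotvE.
by apply/eqP/eqP => [->|H]; [rewrite mxE | apply/rowP => i; rewrite !ord1 H mxE].
Qed.

Lemma dim_orth u : u != 0 -> \dim (orth u) = 2.
Proof.
move=> u0; set f := linfun (mulmxr u^T : E -> 'rV[R]_1).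
have := limg_ker_dim f fullv; rewrite capfv dimvf /dim /= => H.
suff : \dim (limg f) = 1%N by move=> I; move: H; rewrite I addn1 => -[].
apply/eqP; rewrite eqn_leq; apply/andP; split.
  by rewrite (leq_trans (dimvS (subvf _))) // dimvf.
rewrite lt0n dimv_eq0; apply: contraNneq u0 => f0.
rewrite -dotv_eq0 -mem_orth /orth -/f.
by rewrite memv_ker -memv0 -f0 memv_img ?memvf.
Qed.

Lemma orth_eq u v : v != 0 -> (orth v <= orth u)%VS ->
  u = (dotv v u / dotv v v) *: v.
Proof.
move=> v0 vu; have vv : dotv v v != 0 by rewrite dotv_eq0.
set l := _ / _; set w := u - l *: v.
have wv : dotv v w = 0 by rewrite dotvBr dotvZr divfK // subrr.
have : w \in orth u by apply: (subvP vu); rewrite mem_orth wv.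
rewrite mem_orth => /eqP uw; apply/eqP; rewrite -subr_eq0 -/w -dotv_eq0.
by rewrite {1}/w dotvBl uw dotvZl wv mulr0 subrr.
Qed.

Section Polyhedron.
Variables (T : eqType) (K : seq T) (a : T -> E) (b : T -> R) (P : set E).
Hypothesis PE : P = [set x | forall i, i \in K -> dotv (a i) x <= b i].

Lemma strict_perturb y v : (forall i, i \in K -> dotv (a i) y < b i) ->
  exists2 e, 0 < e & P (y + e *: v).
Proof.
rewrite PE /=; elim: K => [_|i s IH ys]; first by exists 1.
have [j js|e e0 es] := IH; first by apply: ys; rewrite inE js orbT.
have d0 : 0 < b i - dotv (a i) y by rewrite subr_gt0 ys ?mem_head.
have [av|av] := lerP (dotv (a i) v) 0.
  exists e => // j; rewrite inE => /predU1P [->|/es //].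
  rewrite dotvDr dotvZr ltW //; have := mulr_ge0_le0 (ltW e0) av; lra.
pose e' := Num.min e ((b i - dotv (a i) y) / dotv (a i) v).
have e'0 : 0 < e' by rewrite lt_min e0 divr_gt0.
exists e' => // j; rewrite inE dotvDr dotvZr => /predU1P [->|js].
  by rewrite addrC -lerBrDr -ler_pdivlMr // ge_min lexx orbT.
have := es j js; rewrite dotvDr dotvZr => H.
have [aj|aj] := lerP 0 (dotv (a j) v).
  by apply: le_trans H; rewrite lerD2l ler_wpM2r // ge_min lexx.
have := ys j; rewrite inE js orbT => /(_ isT).
have : e' * dotv (a j) v < 0 by rewrite pmulr_rlt0.
lra.
Qed.

(** The midpoint of a point strict for some constraints with a point strict for one more is strict
    for all of them; iterating yields a relative interior point of F. *)
Lemma average F (s : seq T) : {subset s <= K} -> F `<=` P ->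
  (forall x y, F x -> F y -> F (2^-1 *: (x + y))) -> F !=set0 ->
  (forall i, i \in s -> exists2 x, F x & dotv (a i) x < b i) ->
  exists2 y, F y & forall i, i \in s -> dotv (a i) y < b i.
Proof.
move=> sK FP Fmid [x0 Fx0]; elim: s sK => [_ _|i s IH sK Fs]; first by exists x0.
have [j js|j js|y Fy ys] := IH; [by apply: sK; rewrite inE js orbT| |].
  by apply: Fs; rewrite inE js orbT.
have [x Fx xi] := Fs i (mem_head _ _).
exists (2^-1 *: (x + y)) => [|j]; first exact: Fmid.
have PF z k : F z -> k \in i :: s -> dotv (a k) z <= b k.
  by move=> /FP; rewrite PE => Pz /sK; apply: Pz.
rewrite inE dotvZr dotvDr => /predU1P [->|js].
  have := PF y i Fy (mem_head _ _); lra.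
have jK : j \in i :: s by rewrite inE js orbT.
have := PF x j Fx jK; have := ys j js; lra.
Qed.

(** If no constraint were tight on all of F, a point of F would be strict for all of them and could
    be moved along c across the supporting plane. A tight constraint i has the same plane as F, so F
    is the full face of i, and any second tight constraint would be proportional to it. *)
Lemma facet_of_polyhedron p F :
  (forall i, i \in K -> dotv (a i) p < b i) ->
  (forall i j (l : R), i \in K -> j \in K -> a i = l *: a j -> b i = l * b j -> i = j) ->
  facets P F ->
  exists i, [/\ i \in K, F = [set x | P x /\ dotv (a i) x = b i] &
    exists2 x, F x & forall j, j \in K -> j != i -> dotv (a j) x < b j].
Proof.
move=> pK Kinj [[c [b0 [cP FE]]] [x0 [U [Fx0 FU Umin dimU]]]].
have FP : F `<=` P by rewrite FE => x [].
have Fc x : F x -> dotv c x = b0 by rewrite FE => -[].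
have Fmid x y : F x -> F y -> F (2^-1 *: (x + y)).
  rewrite FE => -[Px cx] [Py cy]; split.
    move: Px Py; rewrite PE /= => Px Py i iK; rewrite dotvZr dotvDr.
    by have := Px i iK; have := Py i iK; lra.
  by rewrite dotvZr dotvDr cx cy; lra.
have F0 : F !=set0 by exists x0.
have U3 : U <> fullv by move=> UE; move: dimU; rewrite UE dimvf.
have c0 : c != 0.
  (* With c = 0 the face would be all of P, which contains a ball around p and so is not planar. *)
  apply/eqP => c0; apply: U3; apply/vspaceP => w; rewrite memvf.
  have b00 : b0 = 0 by rewrite -(Fc _ Fx0) c0 dotvC dotv0r.
  have PF x : P x -> F x by rewrite FE => Px; split; rewrite // c0 b00 dotvC dotv0r.
  have [e e0 Pe] := strict_perturb w pK.
  have [e' e'0 Pe'] := strict_perturb 0 pK.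
  rewrite scaler0 addr0 in Pe'.
  have := memvB (FU _ (PF _ Pe)) (FU _ (PF _ Pe')).
  rewrite opprB addrA subrK addrC addKr => ew.
  by rewrite -[w]scale1r -(mulVf (lt0r_neq0 e0)) -scalerA memvZ.
have strictF i : i \in K -> ~ (forall x, F x -> dotv (a i) x = b i) ->
    exists2 x, F x & dotv (a i) x < b i.
  move=> iK nF; apply: contrapT => nx; apply: nF => x Fx; apply/eqP.
  rewrite eq_le; apply/andP; split; first by have := FP x Fx; rewrite PE; apply.
  by rewrite leNgt; apply/negP => lt; apply: nx; exists x.
have [i iK Fi] : exists2 i, i \in K & forall x, F x -> dotv (a i) x = b i.
  apply: contrapT => nK.
  have [|y Fy yK] := average (fun _ => id) FP Fmid F0.
    by move=> i iK; apply: strictF => // Fi; apply: nK; exists i.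
  have [e e0 Pe] := strict_perturb c yK.
  have := cP _ Pe; rewrite dotvDr dotvZr (Fc _ Fy) gerDl leNgt.
  by rewrite mulr_gt0 // lt_def dotv_eq0 c0 dotv_ge0.
have a0 j : j \in K -> F `<=` [set x | dotv (a j) x = b j] -> a j != 0.
  move=> jK Fj; apply/eqP => aj; have := pK j jK; have := Fj _ Fx0.
  by rewrite /= aj !(dotvC 0) !dotv0r => <-; rewrite ltxx.
have UE v (r : R) : v != 0 -> (forall x, F x -> dotv v x = r) -> U = orth v.
  move=> v0 Fv; apply/eqP; rewrite eqEdim dimU dim_orth // leqnn andbT.
  by apply: Umin => x Fx; rewrite mem_orth dotvBr !Fv // subrr.
have Ui := UE _ _ (a0 i iK Fi) Fi; have Uc := UE _ _ c0 Fc.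
exists i; split=> //.
  rewrite FE; apply/seteqP; split=> x [Px xE]; split=> //.
    by apply: Fi; rewrite FE.
  have : x - x0 \in U by rewrite Ui mem_orth dotvBr xE (Fi _ Fx0) subrr.
  by rewrite Uc mem_orth dotvBr subr_eq0 => /eqP ->; apply: Fc.
have [||x Fx xK] := average (s := [seq j <- K | j != i]) _ FP Fmid F0.
- by move=> j; rewrite mem_filter => /andP [].
- move=> j; rewrite mem_filter => /andP [ji jK]; apply: strictF => // Fj.
  have Uj := UE _ _ (a0 j jK Fj) Fj.
  have aE := orth_eq (a0 i iK Fi) (u := a j).
  move: aE; rewrite -Ui -Uj => /(_ (subvv _)); set l := _ / _ => aE.
  case/eqP: ji; apply: (Kinj _ _ l) => //.
  by rewrite -(Fj _ Fx0) -(Fi _ Fx0) aE dotvZl.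
- by exists x => // j jK ji; apply: xK; rewrite mem_filter ji.
Qed.

End Polyhedron.
End Facets.

(** * Operations modulo the lattice *)

Definition mk_row (axis : nat) (s : bool) : row :=
  match axis with
  | 0%N => if s then PX else NX
  | 1%N => if s then PY else NY
  | _ => if s then PZ else NZ
  end.

(** The transpose of a signed permutation, found by searching the row that carries axis k. For other
    triples of rows the value is meaningless, and [invertible] tests it by multiplying out. *)
Definition rows_inv (M : rows) : rows :=
  let: (r1, r2, r3) := M in
  let f k := if row_axis r1 == k then mk_row 0 (row_sign r1) else
             if row_axis r2 == k then mk_row 1 (row_sign r2) else
             mk_row 2 (row_sign r3) in
  (f 0%N, f 1%N, f 2%N).

Definition op_inv (h : op) : op :=
  (rows_inv h.1, rows_apply Z.opp (rows_inv h.1) (pscale (Zneg 1) h.2)).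

Definition invertible (h : op) : bool :=
  op_eqb (op_mul h (op_inv h)) op_id && op_eqb (op_mul (op_inv h) h) op_id.

Definition stabilises (GL : seq op) (g : op) : bool :=
  lazy_all (fun a => op_mem GL (op_red (op_mul g a))) GL.

(** Stability under left multiplication by the generators and their inverses passes to the group
    they generate; as [op_id] is listed, every element of that group then reduces into GL. *)
Definition group_ok (gens : seq op) (GL : seq op) : bool :=
  [&& op_mem GL op_id, lazy_all (fun g => op_eqb (op_red g) g) GL,
      lazy_all (fun g => orthogonal_rows g.1) GL &
      lazy_all (fun g => [&& invertible g, stabilises GL g &
                             stabilises GL (op_inv g)]) gens].

Lemma row_oppK : involutive row_opp. Proof. by case. Qed.

Lemma row_apply_opp (T : Type) (opp : T -> T) r v : involutive opp ->
  row_apply opp (row_opp r) v = opp (row_apply opp r v).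
Proof. by move=> oppK; case: v => -[x y] z; case: r => //=; rewrite oppK. Qed.

Lemma rows_apply_comp (T : Type) (opp : T -> T) r M v : involutive opp ->
  row_apply opp (row_apply row_opp r M) v = row_apply opp r (rows_apply opp M v).
Proof.
by move=> oppK; case: M => -[r1 r2] r3; case: r => //=; apply: row_apply_opp.
Qed.

Lemma rows_applyD M (u v : point) :
  rows_apply Z.opp M (padd u v) = padd (rows_apply Z.opp M u) (rows_apply Z.opp M v).
Proof.
case: M u v => -[r1 r2] r3 [[u1 u2] u3] [[v1 v2] v3].
have E r : row_apply Z.opp r (padd (u1, u2, u3) (v1, v2, v3)) =
  Z.add (row_apply Z.opp r (u1, u2, u3)) (row_apply Z.opp r (v1, v2, v3)).
  by case: r => //=; lia.
by rewrite /rows_apply !E.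
Qed.

Lemma op_mulA : associative op_mul.
Proof.
move=> [M t] [M' t'] [M'' t''] /=; congr pair.
  by case: M => -[r1 r2] r3 /=; rewrite !(rows_apply_comp _ _ _ row_oppK).
rewrite rows_applyD.
have -> : rows_apply Z.opp M (rows_apply Z.opp M' t'') =
          rows_apply Z.opp (rows_apply row_opp M M') t''.
  by case: M => -[r1 r2] r3 /=; rewrite !(rows_apply_comp _ _ _ Z.opp_involutive).
move: (rows_apply _ _ t') (rows_apply _ _ t'') (t) => [[? ?] ?] [[? ?] ?] [[? ?] ?].
by rewrite /= !Z.add_assoc.
Qed.

Lemma op_mul1 h : op_mul h op_id = h.
Proof.
case: h => -[[r1 r2] r3] [[t1 t2] t3]; congr pair.
  by case: r1; case: r2; case: r3.
by case: r1; case: r2; case: r3; rewrite /= ?Z.opp_0.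
Qed.

Lemma op_1mul h : op_mul op_id h = h.
Proof.
by case: h => -[[r1 r2] r3] [[t1 t2] t3]; rewrite /= !Z.add_0_r.
Qed.

Lemma invertibleP h : invertible h ->
  op_mul h (op_inv h) = op_id /\ op_mul (op_inv h) h = op_id.
Proof. by rewrite /invertible !op_eqbE => /andP [/eqP -> /eqP ->]. Qed.

Definition shift (k : point) : op := ((PX, PY, PZ), pscale (Zpos 4) k).

Lemma op_redE h : exists k, op_red h = op_mul (shift k) h /\ h = op_mul (shift (pscale (Zneg 1) k)) (op_red h).
Proof.
case: h => -[[r1 r2] r3] [[t1 t2] t3].
exists (Z.opp (Z.div t1 (Zpos 4)), Z.opp (Z.div t2 (Zpos 4)), Z.opp (Z.div t3 (Zpos 4))).
rewrite /op_red /shift /op_mul /=.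
have M t : t = Z.add (Z.mul (Zpos 4) (Z.div t (Zpos 4))) (Z.modulo t (Zpos 4)) by exact: Z.div_mod.
by split; congr (_, (_, _, _)); have := M t1; have := M t2; have := M t3; lia.
Qed.

(** Linear parts map Z^3 into itself, so a lattice translation inside a product moves to the front
    as another lattice translation. *)
Lemma op_red_mull g k h : op_red (op_mul g (op_mul (shift k) h)) = op_red (op_mul g h).
Proof.
case: g h k => -[[r1 r2] r3] [[t1 t2] t3] [N [[s1 s2] s3]] [[k1 k2] k3].
rewrite /op_mul /shift; set N' := rows_apply row_opp (PX, PY, PZ) N.
have -> : N' = N by rewrite /N'; case: (N) => -[[] []] [].
rewrite /op_red.
have E r : exists m, row_apply Z.opp r (padd (rows_apply Z.opp (PX, PY, PZ) (s1, s2, s3)) (pscale (Zpos 4) (k1, k2, k3))) =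
    Z.add (row_apply Z.opp r (s1, s2, s3)) (Z.mul m (Zpos 4)).
  by case: r; [exists k1|exists k2|exists k3|exists (Z.opp k1)|exists (Z.opp k2)|exists (Z.opp k3)] => /=; lia.
have [m1 E1] := E r1; have [m2 E2] := E r2; have [m3 E3] := E r3.
rewrite /rows_apply in E1 E2 E3 *; rewrite {}E1 {}E2 {}E3 /padd.
have M a m t : Z.modulo (Z.add (Z.add a (Z.mul m (Zpos 4))) t) (Zpos 4) = Z.modulo (Z.add a t) (Zpos 4).
  by rewrite -(Z_mod_plus_full (Z.add a t) m); congr Z.modulo; lia.
by rewrite !M.
Qed.

Lemma op_red_mulr g h : op_red (op_mul g h) = op_red (op_mul g (op_red h)).
Proof. by have [k [-> _]] := op_redE h; rewrite op_red_mull. Qed.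

Lemma stabilisesP GL g h : stabilises GL g -> op_red h \in GL ->
  op_red (op_mul g h) \in GL.
Proof.
rewrite /stabilises lazy_allE => /allP gGL hGL.
by rewrite op_red_mulr -op_memE; apply: gGL.
Qed.

Definition normalises (GL : seq op) (n : op) : bool :=
  if invertible n && orthogonal_rows n.1 && orthogonal_rows (op_inv n).1 then
    let n' := op_inv n in
    lazy_all (fun h =>
      if op_mem GL (op_red (op_mul n (op_mul h n'))) then
        op_mem GL (op_red (op_mul n' (op_mul h n))) else false) GL
  else false.

Lemma op_red_conj g h n : op_red (op_mul g (op_mul h n)) =
  op_red (op_mul g (op_mul (op_red h) n)).
Proof.
by have [k [-> _]] := op_redE h; rewrite -op_mulA op_red_mull.
Qed.

Lemma normalisesP GL n : normalises GL n ->
  [/\ invertible n, orthogonal_rows n.1 /\ orthogonal_rows (op_inv n).1,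
      forall h, op_red h \in GL -> op_red (op_mul n (op_mul h (op_inv n))) \in GL &
      forall h, op_red h \in GL -> op_red (op_mul (op_inv n) (op_mul h n)) \in GL].
Proof.
rewrite /normalises; case: ifP => // /andP [/andP [ninv no no']]; rewrite lazy_allE => /allP nGL.
split=> // h hGL; rewrite op_red_conj; have := nGL _ hGL; rewrite !op_memE.
  by case: ifP.
by case: ifP.
Qed.

(** * The action on space and the generated groups *)

Section Action.
Variable R : realType.
Local Open Scope classical_set_scope.
Local Open Scope ring_scope.
Local Notation E := 'rV[R]_3.

Definition vec (v : triple R) : E :=
  let: (a, b, c) := v in \row_(i < 3) [:: a; b; c]`_i.
Definition cor (u : E) : triple R := (u 0 0, u 0 1, u 0 2%:R).

Lemma vecK : cancel vec cor.
Proof. by move=> [[a b] c]; rewrite /cor !mxE. Qed.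

Lemma corK : cancel cor vec.
Proof.
move=> u; apply/rowP => i; rewrite mxE.
case: i => -[|[|[|//]]] i3 /=; congr (u _ _); exact: val_inj.
Qed.

Definition tscale (k : R) (v : triple R) : triple R :=
  let: (a, b, c) := v in (k * a, k * b, k * c).

(* Operations carry translations in units of a quarter of the cell side. *)
Definition move (h : op) (p : triple R) : triple R :=
  tadd (rows_apply -%R h.1 p) (tscale 4^-1 (of_point R h.2)).
Definition act (h : op) (u : E) : E := vec (move h (cor u)).

Lemma cor_act h u : cor (act h u) = move h (cor u).
Proof. by rewrite vecK. Qed.

Lemma move_mul g h p : move (op_mul g h) p = move g (move h p).
Proof.
case: g h p => -[[r1 r2] r3] [[t1 t2] t3] [M s] p; rewrite /move /=.
rewrite !(rows_apply_comp _ _ _ (@opprK _)).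
move: (rows_apply _ M p) s => [[q1 q2] q3] [[s1 s2] s3].
have F r : row_apply -%R r (tadd (q1, q2, q3) (tscale 4^-1 (of_point R (s1, s2, s3)))) =
  row_apply -%R r (q1, q2, q3) + 4^-1 * of_Z R (row_apply Z.opp r (s1, s2, s3)).
  by case: r; rewrite /= ?of_ZN ?mulrN ?opprD.
by rewrite !F /= !of_ZD !mulrDr !addrA.
Qed.

Lemma act_mul g h : act (op_mul g h) = act g \o act h.
Proof. by apply/funext => u; rewrite /act /= vecK move_mul. Qed.

Lemma act_id : act op_id = id.
Proof.
apply/funext => u; transitivity (vec (cor u)); last exact: corK.
by rewrite /act; congr vec; rewrite /move /= !mulr0 !addr0.
Qed.

Lemma act_inj : injective act.
Proof.
move=> g h gh; have {}gh p : move g p = move h p.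
  by have := congr1 (fun f => cor (f (vec p))) gh; rewrite !cor_act !vecK.
have Z_inj a b : 4^-1 * of_Z R a = 4^-1 * of_Z R b -> a = b.
  have q0 : 4^-1 != 0 :> R by rewrite invr_neq0 // pnatr_eq0.
  move/(mulfI q0) => ab.
  by apply: Z.le_antisymm; apply: (@of_Z_leE R); rewrite ab.
move: g h gh => [[[r1 r2] r3] [[t1 t2] t3]] [[[s1 s2] s3] [[u1 u2] u3]] gh.
have row_inj r s t u : (forall p, row_apply -%R r p + 4^-1 * of_Z R t =
    row_apply -%R s p + 4^-1 * of_Z R u) -> r = s /\ t = u.
  move=> H; have H0 := H (0, 0, 0); have H1 := H (1, 0, 0); have H2 := H (0, 1, 0).
  have H3 := H (0, 0, 1); split.
    by move: H0 H1 H2 H3; case: r {H}; case: s => //= H0 H1 H2 H3; exfalso; lra.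
  by apply: Z_inj; move: H0; case: r {H H1 H2 H3}; case: s; rewrite /= ?oppr0 !add0r.
have [|-> ->] := row_inj r1 s1 t1 u1; first by move=> p; have [] := gh p.
have [|-> ->] := row_inj r2 s2 t2 u2; first by move=> p; have [] := gh p.
by have [|-> ->] := row_inj r3 s3 t3 u3; first by move=> p; have [] := gh p.
Qed.

Lemma shift_mul u v : op_mul (shift u) (shift v) = shift (padd u v).
Proof.
by move: u v => [[? ?] ?] [[? ?] ?]; rewrite /shift /=; congr (_, (_, _, _)); lia.
Qed.

Section Generation.
Variables (gens : seq op) (H : set (E -> E)).
Hypothesis Hgrp : is_transformation_group H.
Hypothesis Hgens : forall g, g \in gens -> H (act g).

Let Hmul f g : H f -> H g -> H (f \o g). Proof. by case: Hgrp => _ M _; apply: M. Qed.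

Lemma group_inv g h : op_mul g h = op_id -> H (act g) -> H (act h).
Proof.
move=> gh; case: (Hgrp) => _ _ Hinv /Hinv [f [Hf fg _]].
suff -> : act h = f by [].
apply/funext => x; rewrite -[LHS]fg -[act g _]/((act g \o act h) x).
by rewrite -act_mul gh act_id.
Qed.

Lemma group_shift_line (e : Z -> point) :
  e Z0 = (Z0, Z0, Z0) -> (forall a b, padd (e a) (e b) = e (Z.add a b)) ->
  H (act (shift (e (Zpos 1)))) -> forall a, H (act (shift (e a))).
Proof.
move=> e0 eD H1; have H0 : H (act (shift (e Z0))).
  by rewrite e0 /shift act_id; case: Hgrp.
have HN : H (act (shift (e (Zneg 1)))).
  by apply: (group_inv _ H1); rewrite shift_mul eD e0.
elim/Z.peano_ind => // a Ha.
  by rewrite -[Z.succ a]/(Z.add a (Zpos 1)) -eD -shift_mul act_mul; apply: Hmul.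
rewrite (_ : Z.pred a = Z.add a (Zneg 1)); last by lia.
by rewrite -eD -shift_mul act_mul; apply: Hmul.
Qed.

Hypothesis prim : {subset [:: shift (Zpos 1, Z0, Z0); shift (Z0, Zpos 1, Z0);
  shift (Z0, Z0, Zpos 1)] <= gens}.

Lemma group_shift k : H (act (shift k)).
Proof.
case: k => -[a b] c.
have -> : shift (a, b, c) = op_mul (shift (a, Z0, Z0)) (op_mul (shift (Z0, b, Z0)) (shift (Z0, Z0, c))).
  by rewrite !shift_mul; congr shift; rewrite /= !Z.add_0_r.
rewrite !act_mul; apply: Hmul; last apply: Hmul.
- apply: (@group_shift_line (fun a => (a, Z0, Z0))) => //.
  by apply: Hgens; apply: prim; rewrite !inE eqxx.
- apply: (@group_shift_line (fun a => (Z0, a, Z0))) => //.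
  by apply: Hgens; apply: prim; rewrite !inE eqxx orbT.
- apply: (@group_shift_line (fun a => (Z0, Z0, a))) => //.
  by apply: Hgens; apply: prim; rewrite !inE eqxx !orbT.
Qed.

Lemma group_red h : H (act (op_red h)) <-> H (act h).
Proof.
have [k [E1 E2]] := op_redE h; split=> Hh.
  by rewrite E2 act_mul; apply: Hmul => //; apply: group_shift.
by rewrite E1 act_mul; apply: Hmul => //; apply: group_shift.
Qed.

Lemma closure_from_sub n acc front :
  (forall a, a \in acc -> H (act a)) -> (forall a, a \in front -> H (act a)) ->
  forall a, a \in closure_from n gens acc front -> H (act a).
Proof.
elim: n acc front => [|n IH] acc front Hacc Hfront //=.
set st := foldl _ _ _.
suff: (forall a, a \in st.1 -> H (act a)) /\ (forall a, a \in st.2 -> H (act a)).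
  case: st => acc' [|b front'] [/= H1 H2] //; exact: IH.
rewrite {}/st; have : (forall a, a \in (acc, [::] : seq op).1 -> H (act a)) /\
    (forall a, a \in (acc, [::] : seq op).2 -> H (act a)) by [].
move: (acc, _) => s0; elim: front Hfront s0 => [|a front IHf] Hfront s0 Hs0 //=.
apply: IHf => [b bf|]; first by apply: Hfront; rewrite inE bf orbT.
have Ha : H (act a) by apply: Hfront; rewrite mem_head.
set F := (X in foldl X s0 gens).
suff good gs s : {subset gs <= gens} ->
    (forall a, a \in s.1 -> H (act a)) /\ (forall a, a \in s.2 -> H (act a)) ->
    (forall a, a \in (foldl F s gs).1 -> H (act a)) /\
    (forall a, a \in (foldl F s gs).2 -> H (act a)) by exact: good.
elim: gs s => //= g gs IHg s sub [H1 H2].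
apply: IHg; first by move=> x xs; apply: sub; rewrite inE xs orbT.
rewrite /F; case: ifP => // _.
have Hb : H (act (op_red (op_mul g a))).
  by rewrite group_red act_mul; apply: Hmul => //; apply/Hgens/sub/mem_head.
by split=> x /=; rewrite inE => /predU1P [->|] //; [apply: H1 | apply: H2].
Qed.

Lemma closure_mod_sub h : op_red h \in closure_mod gens -> H (act h).
Proof.
move=> hGL; rewrite -group_red; apply: closure_from_sub hGL.
all: by move=> a; rewrite inE => /eqP ->; rewrite act_id; case: Hgrp.
Qed.

End Generation.

Lemma group_okP gens GL : group_ok gens GL ->
  [/\ op_id \in GL, {in GL, forall g, op_red g = g},
     {in GL, forall g, orthogonal_rows g.1} &
     {in gens, forall g, [/\ invertible g, stabilises GL g & stabilises GL (op_inv g)]}].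
Proof.
case/and4P; rewrite op_memE !lazy_allE => ? /allP h1 /allP h2 /allP h3; split=> //.
  by move=> g /h1; rewrite op_eqbE => /eqP.
by move=> g /h3 /and3P [].
Qed.

Lemma generated_groupE gens (GL := closure_mod gens) :
  group_ok gens GL ->
  {subset [:: shift (Zpos 1, Z0, Z0); shift (Z0, Zpos 1, Z0);
     shift (Z0, Z0, Zpos 1)] <= gens} ->
  generated_group [set f | f \in map act gens] =
  [set act h | h in [set h | op_red h \in GL]].
Proof.
move=> /group_okP [idGL _ _ gensGL] prim; apply/seteqP; split=> f; last first.
  move=> [h hGL <-] H [Hgrp Hgens]; apply: (@closure_mod_sub gens) => //.
  by move=> g gg; apply: Hgens; apply: map_f.
pose stab h := forall a, op_red a \in GL -> op_red (op_mul h a) \in GL.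
(* X is a transformation group containing the generators, hence contains the generated group;
   applying the stability of GL to [op_id] then puts the reduction of h in GL. *)
pose X := [set f : E -> E | exists h h', [/\ op_mul h h' = op_id, op_mul h' h = op_id,
  f = act h, stab h & stab h']].
have XG : is_transformation_group X.
  split.
  - by exists op_id, op_id; rewrite act_id; split=> // a; rewrite op_1mul.
  - move=> f1 f2 [h1 [h1' [E1 E1' -> s1 s1']]] [h2 [h2' [E2 E2' -> s2 s2']]].
    exists (op_mul h1 h2), (op_mul h2' h1'); split.
    + by rewrite -op_mulA (op_mulA h2) E2 op_1mul.
    + by rewrite -op_mulA (op_mulA h1') E1' op_1mul.
    + by rewrite act_mul.
    + by move=> a aGL; rewrite -op_mulA; apply/s1/s2.
    + by move=> a aGL; rewrite -op_mulA; apply/s2'/s1'.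
  - move=> f1 [h [h' [E1 E2 -> s s']]]; exists (act h'); split.
    + by exists h', h.
    + by move=> x; rewrite -[LHS]/((act h' \o act h) x) -act_mul E2 act_id.
    + by move=> x; rewrite -[LHS]/((act h \o act h') x) -act_mul E1 act_id.
move=> /(_ X) [].
  split=> // g /mapP [h /gensGL [hinv s s'] ->].
  have [E1 E2] := invertibleP hinv.
  by exists h, (op_inv h); split=> // a; apply: stabilisesP.
move=> h [h' [_ _ -> s _]]; exists h => //=.
by rewrite -[h]op_mul1; apply: s.
Qed.

End Action.

(** * The fourteen types and elements of their normalisers *)

Section Tables.
Local Open Scope Z_scope.

Definition prim_ops : seq op :=
  [:: shift (1, 0, 0); shift (0, 1, 0); shift (0, 0, 1)].
Definition face_ops : seq op :=
  [:: ((PX, PY, PZ), (0, 2, 2)); ((PX, PY, PZ), (2, 0, 2))].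
Definition body_ops : seq op := [:: ((PX, PY, PZ), (2, 2, 2))].
Definition tetra_ops : seq op :=
  [:: ((NX, NY, PZ), (0, 0, 0)); ((NX, PY, NZ), (0, 0, 0));
      ((PZ, PX, PY), (0, 0, 0))].
Definition tetra_screw_ops : seq op :=
  [:: ((NX, NY, PZ), (0, 2, 2)); ((NX, PY, NZ), (2, 2, 0));
      ((PZ, PX, PY), (0, 0, 0))].

Definition gens_of (t : full_cubic_type) : seq op :=
  prim_ops ++ match t with
  | F23 => face_ops ++ tetra_ops
  | F432 => face_ops ++ tetra_ops ++ [:: ((PY, PX, NZ), (0, 0, 0))]
  | F4b3c => face_ops ++ tetra_ops ++ [:: ((PY, PX, PZ), (2, 2, 2))]
  | F2d3b => face_ops ++ tetra_ops ++ [:: ((NX, NY, NZ), (1, 1, 1))]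
  | P23 => tetra_ops
  | F41_32 => face_ops ++ tetra_screw_ops ++ [:: ((PY, PX, NZ), (3, 1, 3))]
  | P432 => tetra_ops ++ [:: ((PY, PX, NZ), (0, 0, 0))]
  | I23 => body_ops ++ tetra_ops
  | P2n3b => tetra_ops ++ [:: ((NX, NY, NZ), (2, 2, 2))]
  | F41d3b2n => face_ops ++ tetra_screw_ops ++
      [:: ((PY, PX, NZ), (3, 1, 3)); ((NX, NY, NZ), (3, 3, 3))]
  | P4b3n => tetra_ops ++ [:: ((PY, PX, PZ), (2, 2, 2))]
  | P42_32 => tetra_ops ++ [:: ((PY, PX, NZ), (2, 2, 2))]
  | P4n3b2n => tetra_ops ++
      [:: ((PY, PX, NZ), (0, 0, 0)); ((NX, NY, NZ), (2, 2, 2))]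
  | I432 => body_ops ++ tetra_ops ++ [:: ((PY, PX, NZ), (0, 0, 0))]
  end.

Definition elements (t : full_cubic_type) : seq op := closure_mod (gens_of t).

(* Half the period of the translations used to normalise points, in quarters
   of the cell side. *)
Definition half_period (t : full_cubic_type) : Z :=
  match t with
  | F23 | F432 | F4b3c | F2d3b | F41_32 | F41d3b2n => 1
  | _ => 2
  end.

(** For the three exceptions, conjugation by the reflection in z = 0 changes a translation part by
    half a cell edge, which is not a translation of the face-centred lattice; both mirror images of
    the chamber are then needed. *)
Definition has_mirror (t : full_cubic_type) : bool :=
  match t with F2d3b | F41_32 | F41d3b2n => false | _ => true end.

Definition has_half_turn (t : full_cubic_type) : bool :=
  match t with F41_32 | P4b3n | P42_32 => true | _ => false end.

Definition translators (t : full_cubic_type) : seq op :=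
  let s := 2 * half_period t in
  [:: ((PX, PY, PZ), (s, 0, 0)); ((PX, PY, PZ), (0, s, 0));
      ((PX, PY, PZ), (0, 0, s))].
Definition permuters : seq op :=
  [:: ((PY, PX, PZ), (0, 0, 0)); ((PX, PZ, PY), (0, 0, 0))].
Definition flippers : seq op :=
  [:: ((NX, NY, PZ), (0, 0, 0)); ((NX, PY, NZ), (0, 0, 0));
      ((PX, NY, NZ), (0, 0, 0))].
Definition mirror : op := ((PX, PY, NZ), (0, 0, 0)).
(** Each half-turn maps one of the two chambers, z >= 0 or z <= 0, to itself, exchanging the origin
    with the opposite corner (s, s, s) or (s, s, -s); half of the chamber is then enough. *)
Definition half_turns (t : full_cubic_type) : seq op :=
  let s := half_period t in
  [:: ((NZ, NY, NX), (s, s, s)); ((PZ, NY, PX), (s, s, - s))].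

Definition normaliser_lists (t : full_cubic_type) : seq (seq op) :=
  [:: translators t; permuters; flippers;
      if has_mirror t then [:: mirror] else [::];
      if has_half_turn t then half_turns t else [::]].

Definition normalisers (t : full_cubic_type) : seq op :=
  flatten (normaliser_lists t).

(* The computations for type t use the unit 1 / (4 * scale_of t). *)
Definition scale_of (t : full_cubic_type) : Z :=
  match t with
  | F41_32 => 24 | F41d3b2n | P4b3n | P42_32 => 2 | _ => 1
  end.

Definition mirror_sign (positive : bool) : Z := if positive then 1 else -1.

(** The vertices of the chamber |z| <= y <= x <= s with z of a fixed sign. With a half-turn the far
    corner is replaced by the midpoint of its edge to the origin, which imposes x + |z| <= s. *)
Definition start_cell (t : full_cubic_type) (positive : bool) : seq point :=
  let k := scale_of t * half_period t in let e := mirror_sign positive in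
  [:: (0, 0, 0); (k, 0, 0); (k, k, 0);
      if has_half_turn t then (k / 2, k / 2, e * (k / 2)) else (k, k, e * k)].

End Tables.

Section TableChecks.
Variable R : realType.
Local Open Scope ring_scope.

Lemma tripletE (f : R -> R -> R -> R * R * R) h :
  (forall x y z, f x y z = move h (x, y, z)) -> triplet f = act h.
Proof. by move=> fh; apply/funext => u; rewrite /triplet fh. Qed.

Ltac triplets n0 n1 n2 n3 n4 :=
  repeat (congr cons; first by apply: tripletE => x y z;
    rewrite /move /shift /= ?n0 ?n1 ?n2 ?n3 ?n4; congr (_, _, _); lra).

Lemma standard_gensE t : standard_gens R t = map (@act R) (gens_of t).
Proof.
have n1 : of_Z R (Zpos 1) = 1 by [].
have n2 : of_Z R (Zpos 2) = 2 by [].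
have n3 : of_Z R (Zpos 3) = 3 by [].
have n4 : of_Z R (Zpos 4) = 4 by [].
have n0 : of_Z R Z0 = 0 by [].
have primE : primitive_gens R = map (@act R) prim_ops by triplets n0 n1 n2 n3 n4.
have faceE : face_centered_gens R = map (@act R) (prim_ops ++ face_ops).
  by rewrite map_cat -primE; congr cat; triplets n0 n1 n2 n3 n4.
have bodyE : body_centered_gens R = map (@act R) (prim_ops ++ body_ops).
  by rewrite map_cat -primE; congr cat; triplets n0 n1 n2 n3 n4.
have tetraE : tetrahedral_gens R = map (@act R) tetra_ops by triplets n0 n1 n2 n3 n4.
have screwE : tetrahedral_screw_gens R = map (@act R) tetra_screw_ops.
  by triplets n0 n1 n2 n3 n4.
by case: t; rewrite /standard_gens /gens_of ?faceE ?bodyE ?primE ?tetraE ?screwE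
  !map_cat -?catA; do ?[congr cat]; triplets n0 n1 n2 n3 n4.
Qed.

End TableChecks.

Definition scaled (S : Z) (h : op) : op := (h.1, pscale S h.2).
Definition unscaled (S : Z) (h : op) : op := (h.1, point_div h.2 S).

Lemma scaledK S : Z.lt Z0 S -> cancel (scaled S) (unscaled S).
Proof.
move=> S0 [M [[t1 t2] t3]]; rewrite /unscaled /scaled /=; congr (_, (_, _, _)).
all: by rewrite Z.mul_comm Z.div_mul //; lia.
Qed.

Definition all_rows : seq row := [:: PX; PY; PZ; NX; NY; NZ].
(** The bound 16 is four cell sides in quarters, the size from which [excess_far] applies. The list,
    of several million entries, is a finite index set for half-spaces and is never evaluated. *)
Definition small_ops : seq op :=
  let Zs := zrange 33 (Zneg 16) in
  [seq (M, t) | M <- [seq (x, r) | x <- [seq (a, b) | a <- all_rows, b <- all_rows], r <- all_rows],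
                t <- [seq (y, c) | y <- [seq (a, b) | a <- Zs, b <- Zs], c <- Zs]].

Lemma mem_small_ops M t1 t2 t3 :
  Z.le (Z.abs t1) (Zpos 16) -> Z.le (Z.abs t2) (Zpos 16) -> Z.le (Z.abs t3) (Zpos 16) ->
  (M, (t1, t2, t3)) \in small_ops.
Proof.
have inZ t : Z.le (Z.abs t) (Zpos 16) -> t \in zrange 33 (Zneg 16).
  by move=> tle; apply: mem_zrange; lia.
have inR r : r \in all_rows by case: r.
move=> /inZ i1 /inZ i2 /inZ i3; case: M => -[r1 r2] r3.
have inP (A B : eqType) (s : seq A) (s' : seq B) a b : a \in s -> b \in s' ->
    (a, b) \in [seq (x, y) | x <- s, y <- s'].
  by move=> as_ bs; apply/allpairsP; exists (a, b).
rewrite /small_ops; apply: (inP); last by apply: (inP) => //; apply: (inP).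
by apply: (inP) => //; apply: (inP).
Qed.

Definition unit_vectors : seq point :=
  [:: (Zpos 1, Z0, Z0); (Zneg 1, Z0, Z0); (Z0, Zpos 1, Z0);
      (Z0, Zneg 1, Z0); (Z0, Z0, Zpos 1); (Z0, Z0, Zneg 1)].

(** * Dirichlet cells in standard coordinates *)

Section Counting.
Variable R : realType.
Local Open Scope classical_set_scope.
Local Open Scope ring_scope.
Local Open Scope card_scope.
Local Notation E := 'rV[R]_3.

(* phi is a similarity conjugating the group given modulo Z^3 by GL to G. *)
Definition models (GL : seq op) (G : set (E -> E)) (p : E) (phi : E -> E) (q : E) : Prop :=
  [/\ forall e, exists x, phi x = e,
      exists2 c : R, 0 < c &
        forall x y, dotv (phi x - phi y) (phi x - phi y) = c * dotv (x - y) (x - y),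
      forall f, G f <-> exists2 h, op_red h \in GL & f \o phi = phi \o act h &
      p = phi q].

Lemma dotv_cor (x y : E) : dotv (x - y) (x - y) = tdist (cor x) (cor y).
Proof.
rewrite /dotv /tdist /cor /= !big_ord_recl big_ord0 addr0 !mxE addrA.
by congr (_ + _ * _ + _ * _); rewrite /=; congr (x _ _ - y _ _); apply: val_inj.
Qed.

Lemma tdist_scale (k : R) u v : tdist (tscale k u) (tscale k v) = k ^+ 2 * tdist u v.
Proof. by move: u v => [[? ?] ?] [[? ?] ?]; rewrite /tdist /=; ring. Qed.

Lemma op_apply_scaled S h (v : triple R) :
  op_apply (scaled S h) (tscale (4 * of_Z R S) v) = tscale (4 * of_Z R S) (move h v).
Proof.
case: h v => -[[r1 r2] r3] [[t1 t2] t3] [[v1 v2] v3]; rewrite /op_apply /move /=.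
rewrite !of_ZM.
have F r : row_apply -%R r (tscale (4 * of_Z R S) (v1, v2, v3)) =
    4 * of_Z R S * row_apply -%R r (v1, v2, v3) by case: r => /=; ring.
by move: (F r1) (F r2) (F r3) => /= -> -> ->; congr (_, _, _); field.
Qed.

Definition excess (q : E) (h : op) (y : E) : R :=
  dotv (y - act h q) (y - act h q) - dotv (y - q) (y - q).

Lemma excess_gap S (q y : E) h : orthogonal_rows h.1 ->
  gap (scaled S h) (tscale (4 * of_Z R S) (cor y)) (tscale (4 * of_Z R S) (cor q)) =
  (4 * of_Z R S) ^+ 2 * excess q h y.
Proof.
move=> ho; rewrite gapE // op_apply_scaled !tdist_scale -mulrBr.
by rewrite /excess !dotv_cor cor_act.
Qed.

Lemma excess_affine q h y : excess q h y =
  (dotv (act h q) (act h q) - dotv q q) - 2 * dotv (act h q - q) y.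
Proof.
rewrite /excess !(dotvBl, dotvBr) (dotvC y q) (dotvC y (act h q)); lra.
Qed.

Lemma excess_segment q h x (e : R) :
  excess q h (x + e *: (q - x)) = (1 - e) * excess q h x + e * excess q h q.
Proof.
rewrite !excess_affine !dotvDr !dotvZr !dotvBr; lra.
Qed.

Lemma excess_self q h : excess q h q = dotv (q - act h q) (q - act h q).
Proof. by rewrite /excess subrr dotv0r subr0. Qed.

(** The last inequality says e D < (1 - e) g k. On the segment from a facet point to q the facet's
    own form is e D, while any other form that is positive at q is at least (1 - e) times its
    initial value. *)
Lemma small_step (T : eqType) (s : seq T) (g : T -> R) (D M : R) :
  0 <= D -> 0 <= M -> (forall k, k \in s -> 0 < g k) ->
  exists e, [/\ 0 < e, e < 1, e * M < 1 & forall k, k \in s -> e * (D + g k) < g k].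
Proof.
move=> D0 M0; elim: s => [_|a s IH ags].
  have M2 : 0 < M + 2 by lra.
  exists (M + 2)^-1; split; rewrite ?invr_gt0 //.
    by rewrite invf_lt1 //; lra.
  by rewrite mulrC ltr_pdivrMr //; lra.
have [k ks|e [e0 e1 eM es]] := IH; first by apply: ags; rewrite inE ks orbT.
have ga := ags a (mem_head _ _); have Da : 0 < D + g a + 1 by lra.
have f0 : 0 < g a / (D + g a + 1) by rewrite divr_gt0.
exists (Num.min e (g a / (D + g a + 1))); split.
- by rewrite lt_min e0 f0.
- by rewrite gt_min e1.
- by apply: le_lt_trans eM; rewrite ler_wpM2r // ge_min lexx.
move=> k; rewrite inE => /predU1P [->|ks].
  apply: (@le_lt_trans _ _ (g a / (D + g a + 1) * (D + g a))).
    by rewrite ler_wpM2r ?ge_min ?lexx ?orbT //; lra.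
  by rewrite mulrAC ltr_pdivrMr // ltr_pM2l //; lra.
have gk : 0 < g k by apply: ags; rewrite inE ks orbT.
apply: le_lt_trans (es k ks); rewrite ler_wpM2r ?ge_min ?lexx //; lra.
Qed.

Definition near_origin (q : E) : Prop := in_cube 2^-1 (cor q).

(** For the unit translations in direction i, nonnegative excess reads 2 |y_i - q_i| <= 1 after
    expansion. *)
Lemma cell_in_cube q y :
  (forall k, k \in unit_vectors ->
     0 <= excess q (shift k) y) ->
  [/\ `|(cor y).1.1 - (cor q).1.1| <= 2^-1, `|(cor y).1.2 - (cor q).1.2| <= 2^-1 &
      `|(cor y).2 - (cor q).2| <= 2^-1].
Proof.
move=> H.
have ex a b c : excess q (shift (a, b, c)) y =
   tdist (cor y) (tadd (cor q) (of_Z R a, of_Z R b, of_Z R c)) - tdist (cor y) (cor q).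
  rewrite /excess !dotv_cor cor_act; congr (tdist _ _ - _).
  by rewrite /move /shift /cor /= !of_ZM of_Z4; congr (_, _, _); field.
have {ex}H a b c : (a, b, c) \in _ -> 0 <= _ := fun i => eq_ind _ (fun z => 0 <= z) (H _ i) _ (ex a b c).
have n1 : of_Z R (Zpos 1) = 1 by [].
have m1 : of_Z R (Zneg 1) = -1 by [].
have n0 : of_Z R Z0 = 0 by [].
have H1 := H (Zpos 1) Z0 Z0 isT; have H2 := H (Zneg 1) Z0 Z0 isT.
have H3 := H Z0 (Zpos 1) Z0 isT; have H4 := H Z0 (Zneg 1) Z0 isT.
have H5 := H Z0 Z0 (Zpos 1) isT; have H6 := H Z0 Z0 (Zneg 1) isT.
move: H1 H2 H3 H4 H5 H6 {H}; rewrite n0 n1 m1.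
case: (cor y) (cor q) => -[y1 y2] y3 [[q1 q2] q3]; rewrite /tdist /=.
move=> H1 H2 H3 H4 H5 H6; split; rewrite ler_norml; apply/andP; split; nra.
Qed.

Lemma excess_far q y M t1 t2 t3 : near_origin q ->
  [/\ `|(cor y).1.1 - (cor q).1.1| <= 2^-1, `|(cor y).1.2 - (cor q).1.2| <= 2^-1 &
      `|(cor y).2 - (cor q).2| <= 2^-1] ->
  ~ [/\ Z.le (Z.abs t1) (Zpos 16), Z.le (Z.abs t2) (Zpos 16) & Z.le (Z.abs t3) (Zpos 16)] ->
  0 <= excess q (M, (t1, t2, t3)) y.
Proof.
move=> q12 yq far; rewrite /excess !dotv_cor cor_act /move.
case: M => -[r1 r2] r3; move: q12 yq; rewrite /near_origin.
case: (cor y) (cor q) => -[y1 y2] y3 [[q1 q2] q3] [/= h1 h2 h3] [k1 k2 k3].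
have rle r : `|row_apply -%R r (q1, q2, q3)| <= 2^-1.
  by case: r; rewrite /= ?normrN.
have := rle r1; have := rle r2; have := rle r3; rewrite /tdist /=.
set m1 := (match r1 with PX => _ | _ => _ end); set m2 := (match r2 with PX => _ | _ => _ end).
set m3 := (match r3 with PX => _ | _ => _ end).
move: m1 m2 m3 => m1 m2 m3 M3 M2 M1 {rle}.
(* Each coordinate can lower the excess by at most 1/4, while a coordinate with a large translation
   raises it by at least 1, which outweighs the other two. *)
have term (a b m t : R) : `|a - b| <= 2^-1 -> - 4^-1 <=
    (a - (m + t)) * (a - (m + t)) - (a - b) * (a - b).
  rewrite ler_norml => /andP [l u].
  have := sqr_ge0 (a - (m + t)); rewrite expr2.
  have : (a - b) * (a - b) <= 4^-1 by nra.
  lra.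
have big (a b m t : R) : `|a - b| <= 2^-1 -> `|b| <= 2^-1 -> `|m| <= 2^-1 -> 4 <= `|t| ->
    1 <= (a - (m + t)) * (a - (m + t)) - (a - b) * (a - b).
  rewrite !ler_norml => /andP [l u] /andP [bl bu] /andP [ml mu].
  have : (a - b) * (a - b) <= 4^-1 by nra.
  have [t0|t0] := lerP 0 t.
    rewrite ger0_norm // => t4 H; have : 2 <= (m + t) - a by lra.
    by nra.
  rewrite ltr0_norm // => t4 H; have : 2 <= a - (m + t) by lra.
  by nra.
have far4 t : ~ Z.le (Z.abs t) (Zpos 16) -> 4 <= `|4^-1 * of_Z R t|.
  move=> ft; rewrite normrM ger0_norm ?invr_ge0 // mulrC ler_pdivlMr //.
  have -> : 4 * 4 = of_Z R (Zpos 16) by rewrite -(of_Z4 R) -of_ZM.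
  have [t0|t0] : Z.le (Zpos 16) t \/ Z.le (Zpos 16) (Z.opp t) by lia.
    by apply: le_trans (ler_norm _); apply: of_Z_le.
  by rewrite -normrN -of_ZN; apply: le_trans (ler_norm _); apply: of_Z_le.
have T1 := term _ _ m1 (4^-1 * of_Z R t1) k1; have T2 := term _ _ m2 (4^-1 * of_Z R t2) k2.
have T3 := term _ _ m3 (4^-1 * of_Z R t3) k3.
have [/far4 f1|f1] := pselect (~ Z.le (Z.abs t1) (Zpos 16)).
  have := big _ _ _ _ k1 h1 M1 f1; lra.
have [/far4 f2|f2] := pselect (~ Z.le (Z.abs t2) (Zpos 16)).
  have := big _ _ _ _ k2 h2 M2 f2; lra.
have [/far4 f3|f3] := pselect (~ Z.le (Z.abs t3) (Zpos 16)).
  have := big _ _ _ _ k3 h3 M3 f3; lra.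
by case: far; split; apply: contrapT.
Qed.

End Counting.

#[local] Opaque small_ops.

Lemma unit_shifts k : k \in unit_vectors ->
  [/\ op_red (shift k) = op_id, shift k != op_id & shift k \in small_ops].
Proof.
have sh (a b c : Z) : Z.le (Z.abs a) (Zpos 1) -> Z.le (Z.abs b) (Zpos 1) ->
    Z.le (Z.abs c) (Zpos 1) -> shift (a, b, c) \in small_ops.
  by move=> ? ? ?; rewrite /shift /pscale; apply: mem_small_ops; lia.
move=> kin; have : [|| k == (Zpos 1, Z0, Z0), k == (Zneg 1, Z0, Z0), k == (Z0, Zpos 1, Z0) |
     [|| k == (Z0, Zneg 1, Z0), k == (Z0, Z0, Zpos 1) | k == (Z0, Z0, Zneg 1)]].
  by move: kin; rewrite !inE.
case/or4P => [/eqP->|/eqP->|/eqP->|/or3P [/eqP->|/eqP->|/eqP->]].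
all: split; [reflexivity | rewrite -op_eqbE; reflexivity | apply: sh; lia].
Qed.

(** * From the certificate to the number of facets *)

Section FewFacets.
Variable R : realType.
Local Open Scope classical_set_scope.
Local Open Scope ring_scope.
Local Open Scope card_scope.
Local Notation E := 'rV[R]_3.

Variables (GL : seq op) (G : set (E -> E)) (p : E) (phi : E -> E) (q : E).
Hypothesis idGL : op_id \in GL.
Hypothesis orthGL : {in GL, forall g, orthogonal_rows g.1}.
Hypothesis Gmodel : models GL G p phi q.
Hypothesis Ggroup : is_transformation_group G.
Hypothesis stabG : trivial_stabilizer G p.

Let orth_op h : op_red h \in GL -> orthogonal_rows h.1.
Proof. by case: h => M [[t1 t2] t3] hGL; exact: orthGL hGL. Qed.

Lemma models_inj : injective phi.
Proof.
case: Gmodel => _ [c c0 phiE] _ _ x y xy; apply/eqP; rewrite -subr_eq0 -dotv_eq0.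
have /esym/eqP := phiE x y; rewrite xy subrr dotv0r mulf_eq0 (gt_eqF c0) /=.
by [].
Qed.

Lemma models_op h : op_red h \in GL -> exists2 f, G f & f \o phi = phi \o act h.
Proof.
move=> hGL; case: Gmodel => surj _ GE _; have [psi psiK] := choice surj.
have phiK x : psi (phi x) = x by apply: models_inj; rewrite psiK.
exists (phi \o act h \o psi); last by apply/funext => x /=; rewrite phiK.
by apply/GE; exists h => //; apply/funext => x /=; rewrite phiK.
Qed.

Lemma orbit_models : orbit_of G p = [set phi (act h q) | h in [set h | op_red h \in GL]].
Proof.
case: (Gmodel) => _ _ GE pE; apply/seteqP; split=> x.
  move=> [f /GE [h hGL fh] <-]; exists h => //=.
  by rewrite pE -[LHS]/((phi \o act h) q) -fh.
move=> [h /models_op [f Gf fh] <-]; exists f => //.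
by rewrite pE -[LHS]/((f \o phi) q) fh.
Qed.

Lemma models_free h k : op_red h \in GL -> op_red k \in GL ->
  act h q = act k q -> h = k.
Proof.
move=> /models_op [f Gf fh] /models_op [f' Gf' fk] hk.
case: Ggroup => _ Gmul /(_ _ Gf') [g [Gg f'g gf']].
have pE : p = phi q by case: Gmodel.
have : g \o f = id.
  apply: stabG; first exact: Gmul.
  rewrite pE /= -[f (phi q)]/((f \o phi) q) fh /= hk.
  by rewrite -[phi (act k q)]/((phi \o act k) q) -fk /= f'g.
move=> gf; apply: (@act_inj R); apply/funext => x; apply: models_inj.
rewrite -[LHS]/((phi \o act h) x) -fh -[RHS]/((phi \o act k) x) -fk /=.
by rewrite -[LHS]gf' -[g (f _)]/((g \o f) (phi x)) gf.
Qed.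

Variables (S : Z) (n : nat).
Hypothesis S0 : Z.lt Z0 S.
Hypothesis q_small : near_origin q.
Hypothesis few : few_neighbours GL S n (tscale (4 * of_Z R S) (cor q)).

Let P := Vor (orbit_of G p) p.
Let a h : E := 2 *: (phi (act h q) - p).
Let b h : R := dotv (phi (act h q)) (phi (act h q)) - dotv p p.

Lemma half_space_excess : exists2 c : R, 0 < c &
  forall h y, b h - dotv (a h) (phi y) = c * excess q h y.
Proof.
case: Gmodel => _ [c c0 phiE] _ pE; exists c => // h y.
rewrite /excess mulrBr -!phiE -pE /a /b dotvZl !(dotvBl, dotvBr).
rewrite (dotvC (phi y) p) (dotvC (phi y) (phi _)); lra.
Qed.

Lemma vor_half_spaces x :
  P x <-> forall h, op_red h \in GL -> dotv (a h) x <= b h.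
Proof.
have [c c0 cE] := half_space_excess.
have E1 h : enorm (x - p) <= enorm (x - phi (act h q)) <-> dotv (a h) x <= b h.
  rewrite /enorm ler_sqrt ?dotv_ge0 // /a /b dotvZl !(dotvBl, dotvBr).
  rewrite (dotvC x p) (dotvC x (phi _)); split; lra.
rewrite /P orbit_models; split=> [Px h hGL|H r [h hGL <-]]; apply/E1.
  by apply: Px; exists h.
exact: H.
Qed.

Lemma facets_few_neighbours : facets P #<= `I_n.
Proof.
case: few => L [Ks [sL KsP Lmem]].
have [c c0 cE] := half_space_excess.
have [surj _ _ pE] := Gmodel.
(* The small operations already cut out the cell; the competitors of the certificate are added so
   that the point near the facet can be chosen below all of their forms. *)
pose K := [seq h <- small_ops ++ map (unscaled S) Ks | (op_red h \in GL) && (h != op_id)].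
have KP h : h \in K -> op_red h \in GL /\ h != op_id.
  by rewrite mem_filter => /andP [/andP []].
have excess_pos h : h \in K -> 0 < excess q h q.
  move=> /KP [hGL hid]; rewrite excess_self lt_def dotv_ge0 andbT dotv_eq0 subr_eq0.
  apply: contra hid => /eqP qh; apply/eqP; apply: models_free => //.
  by rewrite act_id -qh.
have shiftK k : k \in unit_vectors -> shift k \in K.
  by move=> /unit_shifts [redk kid ksmall]; rewrite mem_filter mem_cat redk idGL kid ksmall.
have in_cell y : (forall h, h \in K -> dotv (a h) (phi y) <= b h) ->
    [/\ `|(cor y).1.1 - (cor q).1.1| <= 2^-1, `|(cor y).1.2 - (cor q).1.2| <= 2^-1 &
      `|(cor y).2 - (cor q).2| <= 2^-1].
  move=> Ky; apply: cell_in_cube => k /shiftK /Ky.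
  by rewrite -subr_ge0 cE pmulr_rge0.
have PE : P = [set x | forall h, h \in K -> dotv (a h) x <= b h].
  apply/seteqP; split=> x.
    by move=> /vor_half_spaces Px h /KP [hGL _]; apply: Px.
  move=> Kx; apply/vor_half_spaces => h hGL; have [y yx] := surj x; subst x.
  have [hK|] := boolP (h \in K); first exact: Kx.
  rewrite mem_filter hGL /= mem_cat negb_and negb_or negbK => /orP [/eqP ->|].
    by rewrite /a /b act_id -pE subrr scaler0 dotvC dotv0r subrr.
  move=> /andP [hsmall _]; rewrite -subr_ge0 cE pmulr_rge0 //.
  case: h hsmall {hGL} => M [[t1 t2] t3] hsmall.
  apply: excess_far => //; first exact: in_cell.
  by case=> l1 l2 l3; apply: (negP hsmall); apply: mem_small_ops.
pose Fof h : set E := [set x | P x /\ dotv (a (unscaled S h)) x = b (unscaled S h)].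
suff H : facets P `<=` (fun i => Fof (nth op_id L i)) @` `I_(size L).
  apply: card_le_trans (subset_card_le H) _.
  by apply: card_le_trans (card_image_le _ _) _; rewrite card_le_II.
move=> F FP.
have [||h [hK FE [x Fx xK]]] := facet_of_polyhedron PE _ _ FP (p := p).
- by move=> h hK; rewrite -subr_gt0 pE cE mulr_gt0 // excess_pos.
(* A bisecting plane determines the image of p as its mirror point: with d_h = l d_k and b_h = l
   b_k, comparison of the constants gives l^2 |d_k|^2 = l |d_k|^2, so l = 1. *)
- move=> h k l hK kK ahk bhk.
  have [hGL _] := KP h hK; have [kGL _] := KP k kK; apply: models_free => //.
  apply: models_inj; have := excess_pos h hK; have := excess_pos k kK.
  rewrite -(pmulr_rgt0 _ c0) -cE -(pmulr_rgt0 (excess q h q) c0) -cE -pE.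
  have two : (2 : R) != 0 by rewrite pnatr_eq0.
  have dE : phi (act h q) - p = l *: (phi (act k q) - p).
    by apply: (scalerI two); move: ahk; rewrite /a scalerA mulrC -scalerA.
  have bE m : b m = dotv (phi (act m q) - p) (phi (act m q) - p) + dotv (a m) p.
    by rewrite /b /a dotvZl !(dotvBl, dotvBr) (dotvC p); lra.
  have aE m : dotv (a m) p = 2 * dotv (phi (act m q) - p) p by rewrite /a dotvZl.
  rewrite bhk ahk dotvZl => kpos hpos.
  have l0 : l != 0 by apply: contraTneq hpos => ->; rewrite !mul0r subrr ltxx.
  move: bhk; rewrite !bE !aE dE !dotvZl dotvZr => E2.
  set D := dotv (phi (act k q) - p) (phi (act k q) - p) in E2.
  have D0 : D != 0 by rewrite gt_eqF //; move: kpos; rewrite bE -/D; lra.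
  have l1 : l = 1.
    have : l * D * (l - 1) = 0 by move: E2; lra.
    by move/eqP; rewrite !mulf_eq0 (negPf l0) (negPf D0) subr_eq0 => /eqP.
  by move: dE; rewrite l1 scale1r => /addIr.
have [x0 x0x] := surj x; subst x.
have [hGL hid] := KP h hK.
have hx0 : excess q h x0 = 0.
  apply/eqP; rewrite -(mulrI_eq0 _ (lregP (lt0r_neq0 c0))) -cE subr_eq0 eq_sym.
  by move: Fx; rewrite FE => -[_ ->].
have kx0 k : k \in [seq k <- K | k != h] -> 0 < excess q k x0.
  rewrite mem_filter => /andP [kh kK].
  by rewrite -(pmulr_rgt0 _ c0) -cE subr_gt0; apply: xK.
pose D := excess q h q; have D0 : 0 < D := excess_pos h hK.
set k2 : R := (4 * of_Z R S) ^+ 2.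
have k20 : 0 < k2 by rewrite exprn_gt0 // mulr_gt0 // -(of_Z0 R) of_Z_lt.
have [|e [e0 e1 eM eK]] := small_step (g := fun k => excess q k x0) (ltW D0) _ kx0 (M := k2 * D).
  by rewrite mulr_ge0 ?ltW.
(* From the facet point x0, where the form of h vanishes and those of the other elements of K are
   positive, a step towards q makes the form of h positive but keeps it the smallest. *)
pose y0 := x0 + e *: (q - x0).
have y0h : excess q h y0 = e * D by rewrite /y0 excess_segment hx0 mulr0 add0r.
have y0k k : k \in K -> k != h -> excess q h y0 < excess q k y0.
  move=> kK kh; have kK' : k \in [seq k <- K | k != h] by rewrite mem_filter kh.
  have := eK k kK'; have := excess_pos k kK; rewrite y0h /y0 excess_segment => pos H.
  have : 0 <= e * excess q k q by rewrite mulr_ge0 ?ltW.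
  by move: H; rewrite mulrDr mulrBl mul1r; lra.
have member_scaled m : op_red m \in GL -> member GL S (scaled S m).
  by move=> mGL; exists m.1, m.2; rewrite -surjective_pairing.
have hL : scaled S h \in L.
  apply: (Lmem _ (tscale (4 * of_Z R S) (cor y0))).
  - exact: member_scaled.
  - by apply: contra hid => /eqP hs; rewrite -(scaledK S0 h) hs.
  (* In each coordinate y0 lies between x0 and q, with |q| <= 1/2 and |x0 - q| <= 1/2; hence y0 lies
     in the cube of half-side one cell. *)
  - have [d1 d2 d3] : [/\ `|(cor x0).1.1 - (cor q).1.1| <= 2^-1,
        `|(cor x0).1.2 - (cor q).1.2| <= 2^-1 & `|(cor x0).2 - (cor q).2| <= 2^-1].
      by apply: in_cell; move: Fx; rewrite FE PE => -[].
    have k0 : 0 < 4 * of_Z R S by rewrite mulr_gt0 // -(of_Z0 R) of_Z_lt.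
    have bound (x z y : R) : `|x - z| <= 2^-1 -> `|z| <= 2^-1 -> y = x + e * (z - x) ->
        `|4 * of_Z R S * y| <= 4 * of_Z R S.
      move=> xz z1 ->; rewrite normrM (gtr0_norm k0) -[leRHS]mulr1 ler_pM2l //.
      rewrite (_ : x + e * (z - x) = z + (1 - e) * (x - z)); last by ring.
      apply: le_trans (ler_normD _ _) _; rewrite normrM gtr0_norm ?subr_gt0 //.
      have : (1 - e) * `|x - z| <= 1 * `|x - z| by rewrite ler_wpM2r //; lra.
      lra.
    case: q_small => s1 s2 s3; rewrite of_ZM of_Z4.
    have yE j : y0 0 j = x0 0 j + e * (q 0 j - x0 0 j) by rewrite !mxE.
    by split; [exact: (bound _ _ _ d1 s1 (yE _)) | exact: (bound _ _ _ d2 s2 (yE _)) |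
               exact: (bound _ _ _ d3 s3 (yE _))].
  - rewrite excess_gap ?orth_op // y0h -/k2 mulrCA eM andbT.
    by rewrite mulr_gt0 // mulr_gt0.
  - move=> k' k'Ks k'h; have [[M [t [k'E tGL]]] k'id] := KsP k' k'Ks.
    have k'S : k' = scaled S (M, t) by [].
    rewrite k'S !excess_gap ?orth_op // -/k2 ltr_pM2l //; apply: y0k.
      rewrite mem_filter tGL andTb; apply/andP; split.
        by apply: contra k'id => /eqP k0; rewrite k'S k0 /scaled /= !Z.mul_0_r.
      rewrite mem_cat; apply/orP; right; apply/mapP; exists k' => //.
      by rewrite k'S scaledK.
    by apply: contra k'h => /eqP <-; rewrite k'S.
exists (index (scaled S h) L); first by rewrite /= index_mem.
by rewrite nth_index // /Fof scaledK.
Qed.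

End FewFacets.

(** * Similarity models of a group of given type *)

Section Models.
Variable R : realType.
Local Open Scope classical_set_scope.
Local Open Scope ring_scope.
Local Notation E := 'rV[R]_3.

(** Conjugation by n preserves the standard group and n is an isometry, so composing the similarity
    with n or its inverse gives another model, with the base point moved the opposite way. *)
Lemma models_normalise GL G p (phi : E -> E) q n : normalises GL n ->
  models GL G p phi q ->
  models GL G p (phi \o act (op_inv n)) (act n q) /\
  models GL G p (phi \o act n) (act (op_inv n) q).
Proof.
move=> /normalisesP [/invertibleP [nn' n'n] [no no'] conj conj'] [surj [c c0 phiE] GE pE].
have iso m x y : orthogonal_rows m.1 ->
    dotv (act m x - act m y) (act m x - act m y) = dotv (x - y) (x - y).
  case: m => -[[r1 r2] r3] [[t1 t2] t3] ho; rewrite !dotv_cor !cor_act.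
  case: (cor x) (cor y) => -[x1 x2] x3 [[y1 y2] y3]; rewrite /tdist /move /=.
  by move: ho; case: r1; case: r2; case: r3 => //= _; ring.
have step m m' : op_mul m m' = op_id -> op_mul m' m = op_id -> orthogonal_rows m.1 ->
    (forall h, op_red h \in GL -> op_red (op_mul m (op_mul h m')) \in GL) ->
    (forall h, op_red h \in GL -> op_red (op_mul m' (op_mul h m)) \in GL) ->
    models GL G p (phi \o act m) (act m' q).
  move=> mm' m'm mo cm cm'.
  have mK x : act m (act m' x) = x.
    by rewrite -[LHS]/((act m \o act m') x) -act_mul mm' act_id.
  split.
  - by move=> e; have [x xe] := surj e; exists (act m' x); rewrite /= mK.
  - by exists c => // x y; rewrite /= phiE iso.
  - move=> f; rewrite GE; split=> -[h hGL fh].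
      exists (op_mul m' (op_mul h m)); first exact: cm'.
      apply/funext => x; have /(congr1 (fun g => g (act m x))) := fh; rewrite /= => ->.
      by rewrite !act_mul /= mK.
    exists (op_mul m (op_mul h m')); first exact: cm.
    apply/funext => x; have /(congr1 (fun g => g (act m' x))) := fh; rewrite /= mK => ->.
    by rewrite !act_mul.
  - by rewrite /= mK.
by split; apply: step.
Qed.

(* The half-turns and the three-fold rotation of the tetrahedral group force
   the quadratic form |uA|^2 to be a multiple of |u|^2. *)
Lemma tetrahedral_similarity (A : 'M[R]_3) :
  (forall r, r \in [:: (NX, NY, PZ); (NX, PY, NZ); (PZ, PX, PY)] -> forall u : E,
     dotv (act (r, (Z0, Z0, Z0)) u *m A) (act (r, (Z0, Z0, Z0)) u *m A) =
     dotv (u *m A) (u *m A)) ->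
  exists c : R, forall u : E, dotv (u *m A) (u *m A) = c * dotv u u.
Proof.
move=> inv; pose Q (a b c : R) := dotv (vec (a, b, c) *m A) (vec (a, b, c) *m A).
pose e1 : E := vec (1, 0, 0); pose e2 : E := vec (0, 1, 0); pose e3 : E := vec (0, 0, 1).
pose B (u v : E) := dotv (u *m A) (v *m A).
have QE a b c : Q a b c = a ^+ 2 * B e1 e1 + b ^+ 2 * B e2 e2 + c ^+ 2 * B e3 e3 +
   2 * (a * b * B e1 e2 + a * c * B e1 e3 + b * c * B e2 e3).
  have vE : vec (a, b, c) = a *: e1 + b *: e2 + c *: e3.
    apply/rowP => i; rewrite !mxE; case: i => -[|[|[|//]]] i3 /=; ring.
  rewrite /Q vE !mulmxDl -!scalemxAl !(dotvDl, dotvDr, dotvZl, dotvZr) /B.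
  rewrite (dotvC (e2 *m A) (e1 *m A)) (dotvC (e3 *m A) (e1 *m A)) (dotvC (e3 *m A) (e2 *m A)).
  by ring.
have inv1 a b c : Q (- a) (- b) c = Q a b c.
  have := inv (NX, NY, PZ) isT (vec (a, b, c)); rewrite /act vecK /move /=.
  by rewrite !mulr0 !addr0.
have inv2 a b c : Q (- a) b (- c) = Q a b c.
  have := inv (NX, PY, NZ) isT (vec (a, b, c)); rewrite /act vecK /move /=.
  by rewrite !mulr0 !addr0.
have inv3 a b c : Q c a b = Q a b c.
  have := inv (PZ, PX, PY) isT (vec (a, b, c)); rewrite /act vecK /move /=.
  by rewrite !mulr0 !addr0.
exists (B e1 e1) => u; rewrite -[u]corK; move: (cor u) => [[a b] c].
rewrite -/(Q a b c) QE.
have := inv1 1 0 1; have := inv1 0 1 1; have := inv2 1 1 0.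
have := inv3 1 0 0; have := inv3 0 1 0; rewrite !QE => h1 h2 h3 h4 h5.
have b12 : B e1 e2 = 0 by lra.
have b13 : B e1 e3 = 0 by lra.
have b23 : B e2 e3 = 0 by lra.
have b22 : B e2 e2 = B e1 e1 by lra.
have b33 : B e3 e3 = B e1 e1 by lra.
rewrite b12 b13 b23 b22 b33 /dotv !big_ord_recl big_ord0 !mxE /=; ring.
Qed.

Lemma models_of_type (t : full_cubic_type) (G : set (E -> E)) (p : E) :
  group_ok (gens_of t) (elements t) ->
  {subset tetra_ops <= elements t} ->
  G `<=` @is_isometry R -> has_type G t ->
  exists phi q, models (elements t) G p phi q.
Proof.
move=> ok tetra iso [A [v [Aunit GE]]].
pose phi (x : E) := x *m A + v.
have stdE : standard_group t = [set @act R h | h in [set h | op_red h \in elements t]].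
  rewrite /standard_group standard_gensE; apply: generated_groupE => //.
  by move=> g; rewrite /gens_of mem_cat => ->.
have GE' f : G f <-> exists2 h, op_red h \in elements t & f \o phi = phi \o act h.
  rewrite GE stdE; split.
    by case=> _ [h hGL <-] fh; exists h.
  by case=> h hGL fh; exists (act h) => //; exists h.
have surj e : exists x, phi x = e.
  by exists ((e - v) *m invmx A); rewrite /phi mulmxKV // subrK.
have [psi psiK] := choice surj.
have phiB x y : phi x - phi y = (x - y) *m A.
  by rewrite /phi opprD addrACA subrr addr0 mulmxBl.
have phiK x : psi (phi x) = x.
  apply: (can_inj (mulmxK Aunit)); apply/eqP; rewrite -subr_eq0 -mulmxBl -phiB.
  by rewrite psiK subrr.
have [c cE] : exists c : R, forall u : E, dotv (u *m A) (u *m A) = c * dotv u u.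
  apply: tetrahedral_similarity => r rin u; set h := (r, _).
  have hGL : op_red h \in elements t.
    by apply: tetra; move: rin; rewrite /h !inE => /or3P [] /eqP ->.
  have act0 : act h (0 : E) = 0.
    rewrite -[LHS]corK -[RHS]corK; congr vec; rewrite cor_act /move /h /cor !mxE.
    by move: rin; rewrite !inE => /or3P [] /eqP -> /=; rewrite ?oppr0 !mulr0 !addr0.
  (* The conjugate of an operation fixing the origin lies in G and so is an isometry; comparing the
     images of phi u and phi 0 yields the invariance of |uA|^2. *)
  pose f := phi \o act h \o psi.
  have fphi : f \o phi = phi \o act h by apply/funext => x; rewrite /f /= phiK.
  have Gf : G f by apply/GE'; exists h.
  have := iso f Gf (phi u) (phi 0).
  rewrite -[f (phi u)]/((f \o phi) u) -[f (phi 0)]/((f \o phi) 0) fphi /= !phiB act0 !subr0.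
  by move/eqP; rewrite /enorm eqr_sqrt ?dotv_ge0 // => /eqP.
exists phi, (psi p); split=> //; exists c; last by move=> x y; rewrite phiB cE.
pose e1 : E := vec (1, 0, 0).
have e1n : e1 != 0.
  by apply/eqP => /(congr1 (fun u : E => u 0 0)); rewrite !mxE /= => /eqP; rewrite oner_eq0.
have e1A : e1 *m A != 0.
  by apply: contra e1n => /eqP e0; rewrite -(mulmxK Aunit e1) e0 mul0mx.
have pos (u : E) : u != 0 -> 0 < dotv u u by move=> u0; rewrite lt_def dotv_eq0 u0 dotv_ge0.
have := pos _ e1A; rewrite cE pmulr_lgt0 //; exact: pos.
Qed.

End Models.

(** * Subdivision plans and the verified computations *)

Section Plans.
Local Open Scope Z_scope.

(* The subdivisions were found by experiment. For F41_32 the cell is first cut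
   along the axis of the half-turn that normalises the group and preserves the
   chamber. *)
Definition plan_of (t : full_cubic_type) (positive : bool) : plan :=
  match t with
  | F23 | F432 | F4b3c | F2d3b => Check 1 6
  | P23 | P432 | I23 | P2n3b | I432 => Check 4 3
  | P4n3b2n => Check 1 3
  | F41d3b2n =>
      if positive then Check 4 6 else Cut 2 1 1 (Check 4 6) (Check 4 6)
  | P4b3n | P42_32 =>
      Cut 1 1 1 (Check 16 6) (Cut 3 1 1 (Check 16 6) (Check 16 6))
  | F41_32 =>
      let c := Check 1728 6 in
      if positive then
        Cut 3 1 1 (Check 1000 6) (Cut 3 2 1 (Check 1000 6) (Check 1000 8))
      else
        Cut 3 1 1 (Cut 3 1 1 (Cut 5 1 1 c c) (Cut 3 1 1 c (Cut 4 1 1 c c)))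
          (Cut 3 1 1 (Cut 2 1 1 (Cut 1 1 1 c c) c) c)
  end.

Definition type_ok (t : full_cubic_type) : bool :=
  [&& group_ok (gens_of t) (elements t),
      lazy_all (op_mem (elements t)) tetra_ops &
      lazy_all (normalises (elements t)) (normalisers t)].

Definition cells_ok (t : full_cubic_type) (positive : bool) : bool :=
  plan_ok (scale_of t) (elements t) (facet_bound t) (plan_of t positive)
    (start_cell t positive).

End Plans.

Lemma type_okP t : type_ok t.
Proof. by case: t; vm_compute. Qed.

(** The case distinction stands in the statement so that [vm_compute] never runs the check on the
    negative chamber of a type with a mirror. *)
Lemma cells_ok_mirror t : if has_mirror t then cells_ok t true else true.
Proof. by case: t; vm_compute. Qed.

Lemma cells_ok_no_mirror t (positive : bool) : if has_mirror t then true else cells_ok t positive.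
Proof. by case: positive; case: t; vm_compute. Qed.

Lemma cells_okP t (positive : bool) : (has_mirror t -> positive) -> cells_ok t positive.
Proof.
have := cells_ok_mirror t; have := cells_ok_no_mirror t positive.
by case: (has_mirror t) => // H1 H2 /(_ isT) ->.
Qed.

#[local] Opaque elements closure_mod plan_ok normalises.

(** * Moving the base point into the chamber *)

Section NormalForm.
Variable R : realType.
Local Open Scope classical_set_scope.
Local Open Scope ring_scope.
Local Open Scope card_scope.
Local Notation E := 'rV[R]_3.
Local Notation zr := (@of_Z R).

Lemma periodic_reduction (s : R) (Q : R -> Prop) x : 0 < s ->
  (forall y, Q y -> Q (y + 2 * s) /\ Q (y - 2 * s)) -> Q x ->
  exists2 y, `|y| <= s & Q y.
Proof.
move=> s0 Qs Qx.
have Qn (k : nat) : Q (x + 2 * s * k%:R) /\ Q (x - 2 * s * k%:R).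
  elim: k => [|k [IH1 IH2]]; first by rewrite mulr0 addr0 subr0.
  have [H1 _] := Qs _ IH1; have [_ H2] := Qs _ IH2; have E : k.+1%:R = k%:R + 1 :> R by rewrite natr1.
  by rewrite E mulrDr mulr1 addrA opprD addrA.
have Qm (m : int) : Q (x - 2 * s * m%:~R).
  case: m => k; first by have [] := Qn k.
  by rewrite NegzE mulrNz mulrN opprK; have [] := Qn k.+1.
(* This m is an integer nearest to x / (2 s). *)
pose m := Num.floor (x / (2 * s) + 2^-1).
exists (x - 2 * s * m%:~R) => //.
have s2 : 0 < 2 * s by lra.
have mx : m%:~R <= x / (2 * s) + 2^-1 := floor_le _.
have xm : x / (2 * s) + 2^-1 < (m + 1)%:~R := floorD1_gt _.
rewrite intrD in xm.
have xE : x = 2 * s * (x / (2 * s)) by rewrite mulrC divfK // gt_eqF.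
set z := x / (2 * s) in mx xm xE *.
have l1 : 2 * s * m%:~R <= 2 * s * (z + 2^-1) by rewrite ler_pM2l.
have l2 : 2 * s * (z + 2^-1) <= 2 * s * (m%:~R + 1) by rewrite ler_pM2l // ltW.
rewrite ler_norml; move: l1 l2; rewrite !mulrDr -xE => l1 l2.
by apply/andP; split; lra.
Qed.

Variables (t : full_cubic_type) (G : set (E -> E)) (p : E).

Definition reachable (v : triple R) : Prop :=
  exists phi, models (elements t) G p phi (vec v).

Lemma reachable_normalise n v : n \in normalisers t -> reachable v ->
  reachable (move n v) /\ reachable (move (op_inv n) v).
Proof.
have /and3P [_ _] := type_okP t; rewrite lazy_allE => /allP ok nt [phi phiv].
have [H1 H2] := models_normalise (ok n nt) phiv; split.
  by exists (phi \o act (op_inv n)); move: H1; rewrite /act vecK.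
by exists (phi \o act n); move: H2; rewrite /act vecK.
Qed.

Let s : R := zr (half_period t) / 4.

Lemma half_period_bounds : 0 < s /\ s <= 2^-1.
Proof.
have n1 : zr (Zpos 1) = 1 by [].
have n2 : zr (Zpos 2) = 2 by [].
by rewrite /s; case: t; rewrite /= ?n1 ?n2; split; lra.
Qed.

Lemma normal_form v : reachable v -> exists x y z, [/\ reachable (x, y, z),
  [/\ `|z| <= y, y <= x & x <= s], has_mirror t -> 0 <= z &
  has_half_turn t -> x + `|z| <= s].
Proof.
have [s0 _] := half_period_bounds.
have n2 : zr (Z.mul (Zpos 2) (half_period t)) = 8 * s by rewrite of_ZM of_Z2 /s; field.
have inN (n : op) (l : seq op) : n \in l -> l \in normaliser_lists t ->
    n \in normalisers t by move=> nl ll; apply/flattenP; exists l.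
have conv u w : reachable u -> u = w -> reachable w by move=> ? <-.
have tx x y z : reachable (x, y, z) -> reachable (x + 2 * s, y, z) /\ reachable (x - 2 * s, y, z).
  move=> /(reachable_normalise (inN _ (translators t) (mem_head _ _) (mem_head _ _))) [H1 H2].
  by split; [apply: conv H1 _ | apply: conv H2 _];
    rewrite /move /= ?of_ZN ?n2 ?of_Z0; congr (_, _, _); field.
have ty x y z : reachable (x, y, z) -> reachable (x, y + 2 * s, z) /\ reachable (x, y - 2 * s, z).
  have i : ((PX, PY, PZ), (Z0, Z.mul (Zpos 2) (half_period t), Z0)) \in translators t.
    by rewrite !in_cons eqxx orbT.
  move=> /(reachable_normalise (inN _ (translators t) i (mem_head _ _))) [H1 H2].
  by split; [apply: conv H1 _ | apply: conv H2 _];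
    rewrite /move /= ?of_ZN ?n2 ?of_Z0; congr (_, _, _); field.
have tz x y z : reachable (x, y, z) -> reachable (x, y, z + 2 * s) /\ reachable (x, y, z - 2 * s).
  have i : ((PX, PY, PZ), (Z0, Z0, Z.mul (Zpos 2) (half_period t))) \in translators t.
    by rewrite !in_cons eqxx !orbT.
  move=> /(reachable_normalise (inN _ (translators t) i (mem_head _ _))) [H1 H2].
  by split; [apply: conv H1 _ | apply: conv H2 _];
    rewrite /move /= ?of_ZN ?n2 ?of_Z0; congr (_, _, _); field.
have id_shift x y z : tadd (x, y, z) (tscale 4^-1 (zr Z0, zr Z0, zr Z0)) = (x, y, z).
  by rewrite /= of_Z0 mulr0 !addr0.
have lin (M : rows) x y z (l : seq op) : (M, (Z0, Z0, Z0)) \in l -> l \in normaliser_lists t ->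
    reachable (x, y, z) -> reachable (rows_apply -%R M (x, y, z)).
  move=> Ml ll /(reachable_normalise (inN _ _ Ml ll)) [H _]; move: H; rewrite /move.
  by case: M {Ml} => -[r1 r2] r3; rewrite [of_point _]/= id_shift.
have pin : permuters \in normaliser_lists t by rewrite /normaliser_lists !in_cons eqxx orbT.
have fin : flippers \in normaliser_lists t by rewrite /normaliser_lists !in_cons eqxx !orbT.
have pxy x y z : reachable (x, y, z) -> reachable (y, x, z) := @lin (PY, PX, PZ) x y z permuters isT pin.
have pyz x y z : reachable (x, y, z) -> reachable (x, z, y) := @lin (PX, PZ, PY) x y z permuters isT pin.
have fxy x y z : reachable (x, y, z) -> reachable (- x, - y, z) := @lin (NX, NY, PZ) x y z flippers isT fin.
have fxz x y z : reachable (x, y, z) -> reachable (- x, y, - z) := @lin (NX, PY, NZ) x y z flippers isT fin.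
have fyz x y z : reachable (x, y, z) -> reachable (x, - y, - z) := @lin (PX, NY, NZ) x y z flippers isT fin.
case: v => -[x y] z rv.
have [x1 x1s {}rv] := periodic_reduction s0 (fun u => tx u y z) rv.
have [y1 y1s {}rv] := periodic_reduction s0 (fun u => ty x1 u z) rv.
have [z1 z1s {}rv] := periodic_reduction s0 (fun u => tz x1 y1 u) rv.
have [x2 [y2 [z2 [{}rv zy2 yx2 xs2]]]] : exists x y z, [/\ reachable (x, y, z),
    `|z| <= `|y|, `|y| <= `|x| & `|x| <= s].
  have [xy|yx] := lerP `|x1| `|y1|; have [yz|zy] := lerP `|y1| `|z1|;
    have [xz|zx] := lerP `|x1| `|z1|.
  - by exists z1, y1, x1; split=> //; apply/pyz/pxy/pyz.
  - by exists z1, y1, x1; split=> //; apply/pyz/pxy/pyz.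
  - by exists y1, z1, x1; split=> //; [exact/pyz/pxy | exact: ltW].
  - by exists y1, x1, z1; split=> //; [exact/pxy | exact: ltW].
  - by exists z1, x1, y1; split=> //; [exact/pxy/pyz | exact: ltW].
  - by exists x1, z1, y1; split=> //; [exact/pyz | exact: ltW].
  - by exists x1, y1, z1; split=> //; [exact: ltW | exact: ltW].
  - by exists x1, y1, z1; split=> //; [exact: ltW | exact: ltW].
(* The available sign changes act on two coordinates at a time: x and y are made nonnegative and z
   absorbs the parity. *)
have [x3 [y3 [z3 [{}rv zy3 yx3 xs3]]]] : exists x y z, [/\ reachable (x, y, z),
    `|z| <= y, y <= x & x <= s].
  exists `|x2|, `|y2|; have [x0|x0] := lerP 0 x2; have [y0|y0] := lerP 0 y2.
  - exists z2; split=> //; rewrite ?(ger0_norm x0) ?(ger0_norm y0) //.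
  - exists (- z2); rewrite normrN; split=> //; rewrite ?(ger0_norm x0) ?(ltr0_norm y0) //.
    exact: fyz.
  - exists (- z2); rewrite normrN; split=> //; rewrite ?(ltr0_norm x0) ?(ger0_norm y0) //.
    exact: fxz.
  - exists z2; split=> //; rewrite ?(ltr0_norm x0) ?(ltr0_norm y0) //.
    exact: fxy.
have [z4 [{}rv zy4 z4m]] : exists z, [/\ reachable (x3, y3, z), `|z| <= y3 &
    has_mirror t -> 0 <= z].
  have [m|_] := boolP (has_mirror t); last by exists z3.
  have min : [:: mirror] \in normaliser_lists t.
    by rewrite /normaliser_lists m !in_cons eqxx !orbT.
  have [z0|z0] := lerP 0 z3; first by exists z3.
  exists (- z3); rewrite normrN; split=> //; last by rewrite oppr_ge0 ltW.
  exact: (@lin (PX, PY, NZ) _ _ _ [:: mirror] isT min).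
have [h|_] := boolP (has_half_turn t); last by exists x3, y3, z4.
have [small|big] := lerP (x3 + `|z4|) s; first by exists x3, y3, z4.
have hin : half_turns t \in normaliser_lists t.
  by rewrite /normaliser_lists h !in_cons eqxx !orbT.
have hs : zr (half_period t) = 4 * s by rewrite /s; field.
have h1 : ((NZ, NY, NX), (half_period t, half_period t, half_period t)) \in half_turns t.
  by rewrite in_cons eqxx.
have h2 : ((PZ, NY, PX), (half_period t, half_period t, Z.opp (half_period t))) \in half_turns t.
  by rewrite !in_cons eqxx orbT.
(* The half-turn replaces x and |z| by s - |z| and s - x, and y by s - y. This preserves the order
   of the coordinates and turns the sum x + |z| into 2 s minus itself, so a sum above s falls below
   s. *)
have [z0|z0] := lerP 0 z4.
  have [{}rv _] := reachable_normalise (inN _ _ h1 hin) rv.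
  exists (s - z4), (s - y3), (s - x3); move: big zy4 z4m; rewrite (ger0_norm z0) => big zy4 z4m.
  have sx : 0 <= s - x3 by lra.
  rewrite (ger0_norm sx); split; [|split; lra|by move=> _|by move=> _; lra].
  by apply: conv rv _; rewrite /move /= hs; congr (_, _, _); field.
have [{}rv _] := reachable_normalise (inN _ _ h2 hin) rv.
exists (s + z4), (s - y3), (x3 - s); move: big zy4 z4m; rewrite (ltr0_norm z0) => big zy4 z4m.
have sx : x3 - s <= 0 by lra.
rewrite (ler0_norm sx); split; [|split; lra| |by move=> _; lra].
  by apply: conv rv _; rewrite /move /= of_ZN hs; congr (_, _, _); field.
by move=> /z4m; rewrite leNgt z0.
Qed.

End NormalForm.

(** * The chamber as a simplex, and the theorem *)

Section Main.
Variable R : realType.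
Local Open Scope classical_set_scope.
Local Open Scope ring_scope.
Local Open Scope card_scope.
Local Notation zr := (@of_Z R).

Lemma start_cell_hull t (x y z : R) (s := zr (half_period t) / 4) :
  `|z| <= y -> y <= x -> x <= s -> (has_half_turn t -> x + `|z| <= s) ->
  hull (start_cell t (0 <= z)) (tscale (4 * zr (scale_of t)) (x, y, z)).
Proof.
move=> zy yx xs half; have [s0 _] := half_period_bounds R t; rewrite -/s in s0.
have s0' : s != 0 by rewrite gt_eqF.
have hs : zr (half_period t) = 4 * s by rewrite /s; field.
pose e : R := if 0 <= z then 1 else -1.
have ze : z = e * `|z|.
  rewrite /e; case: ifPn => z0; first by rewrite mul1r ger0_norm.
  by rewrite ltr0_norm ?ltNge // mulN1r opprK.
have mE : zr (mirror_sign (0 <= z)) = e by rewrite /e; case: ifP.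
have z0 := normr_ge0 z.
rewrite [X in tscale _ (_, X)]ze /start_cell; set k := Z.mul _ _.
have kE : zr k = 4 * zr (scale_of t) * s by rewrite /k of_ZM hs; ring.
case: ifPn => [ht|_].
  have k2 : zr (Z.div k (Zpos 2)) = 2 * zr (scale_of t) * s.
    have : Z.mul (Zpos 2) (Z.div k (Zpos 2)) = k.
      (* For the three types with a half-turn the integer k is 24 or 4, hence even. *)
      by move: ht; rewrite /k; case: (t).
    by move/(congr1 (@of_Z R)); rewrite of_ZM of_Z2 kE => H; lra.
  (* The fourth vertex is half the far corner, so its weight doubles and the first weight drops
     accordingly; that weight is nonnegative exactly by x + |z| <= s. *)
  clearbody k; apply/hull4P; exists (1 - (x + `|z|) / s), ((x - y) / s), ((y - `|z|) / s), (2 * `|z| / s).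
  split.
  - split; [by rewrite subr_ge0 ler_pdivrMr // mul1r half | | |];
      apply: divr_ge0 (ltW s0); rewrite ?subr_ge0 //; exact: mulr_ge0.
  - by field.
  - by case; rewrite /coord /= ?of_ZN ?of_ZM ?mE ?kE ?k2 of_Z0; field.
clearbody k; apply/hull4P; exists (1 - x / s), ((x - y) / s), ((y - `|z|) / s), (`|z| / s).
split.
- split; [by rewrite subr_ge0 ler_pdivrMr // mul1r | | |];
    by apply: divr_ge0 (ltW s0); rewrite ?subr_ge0.
- by field.
- by case; rewrite /coord /= ?of_ZN ?of_ZM ?mE ?kE of_Z0; field.
Qed.

End Main.

Local Open Scope classical_set_scope.
Local Open Scope ring_scope.
Local Open Scope card_scope.

Theorem mainTheorem2 (R : realType) (t : full_cubic_type)
    (G : set ('rV[R]_3 -> 'rV[R]_3)) (p : 'rV[R]_3) :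
  crystallographic G -> has_type G t -> trivial_stabilizer G p ->
  facets (Vor (orbit_of G p) p) #<= `I_(facet_bound t).
Proof.
move=> [Ggroup Giso _ _] Gt stab.
have /and3P [ok tetra _] := type_okP t.
have [idGL redGL orthGL _] := group_okP ok.
have tetra_in : {subset tetra_ops <= elements t}.
  by move: tetra; rewrite lazy_allE => /allP H g /H; rewrite op_memE.
have [phi0 [q0 model0]] := models_of_type p ok tetra_in Giso Gt.
have start : reachable t G p (cor q0) by exists phi0; rewrite corK.
have [x [y [z [[phi model] [zy yx xs] mir half]]]] := normal_form start.
have S0 : Z.lt Z0 (scale_of t) by case: (t).
have [s0 s2] := half_period_bounds R t.
have z0 := normr_ge0 z.
apply: (facets_few_neighbours idGL orthGL model Ggroup stab S0).
  rewrite /near_origin vecK; split=> /=; last by apply: le_trans zy (le_trans yx (le_trans xs s2)).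
    by rewrite ger0_norm ?(le_trans xs) // (le_trans z0 (le_trans zy yx)).
  by rewrite ger0_norm ?(le_trans yx (le_trans xs s2)) // (le_trans z0 zy).
rewrite vecK; apply: plan_okP (start_cell_hull zy yx xs half) (cells_okP mir) => //.
Qed.
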